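(* Let $\alpha\in\mathbb R\setminus\{0,1\}$ and $\lambda\in\{1,\alpha\}$. The Fock representation $\rho_\lambda$ of the real Lie superalgebra $\mathfrak g=\mathrm{TKK}(D_\alpha)\cong D(2,1;\alpha)$ on $\mathcal F_\lambda$ is skew-supersymmetric with respect to the Bessel–Fischer product, i.e. $$\langle\rho_\lambda(X)p,q\rangle_{\mathcal B}=-(-1)^{|X||p|}\langle p,\rho_\lambda(X)q\rangle_{\mathcal B}$$ for all (homogeneous) $X\in\mathfrak g$ and $p,q\in\mathcal F_\lambda$.
   Context: $\mathcal P(\mathbb C^{2|2})=\mathbb C[z_1,z_2]\otimes\Lambda(z_3,z_4)$, with $z_1,z_2$ even and $z_3,z_4$ odd; $|\cdot|$ denotes parity and $\partial_i=\partial_{z_i}$ are the (left) partial superderivatives. The Bessel operators are $\mathcal B_\lambda(z_1)=(-\lambda+z_1\partial_1+z_3\partial_3+z_4\partial_4)\partial_1-2\alpha z_2\partial_3\partial_4$, $\mathcal B_\lambda(z_2)=(-\tfrac{\lambda}{\alpha}+z_2\partial_2+z_3\partial_3+z_4\partial_4)\partial_2-2z_1\partial_3\partial_4$, $\mathcal B_\lambda(z_3)=(-2\lambda+2z_1\partial_1+2\alpha z_2\partial_2+2(1+\alpha)z_3\partial_3)\partial_4+z_3\partial_1\partial_2$, $\mathcal B_\lambda(z_4)=(2\lambda-2z_1\partial_1-2\alpha z_2\partial_2-2(1+\alpha)z_4\partial_4)\partial_3+z_4\partial_1\partial_2$. They supercommute. $\mathcal I_\lambda$ is the ideal of $\mathcal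 P(\mathbb C^{2|2})$ generated by $2z_1z_2+z_3z_4,\ z_2^2,\ z_2z_3,\ z_2z_4$ if $\lambda=\alpha$, and by $2\alpha z_1z_2+z_3z_4,\ z_1^2,\ z_1z_3,\ z_1z_4$ if $\lambda=1$. $\mathcal F_\lambda=\mathcal P(\mathbb C^{2|2})/\mathcal I_\lambda$. The Bessel–Fischer product is $\langle p,q\rangle_{\mathcal B}=p(\mathcal B_\lambda)\,\bar q(z)|_{z=0}$, where $p(\mathcal B_\lambda)$ is obtained by replacing each monomial $z_1^{\gamma_1}z_2^{\gamma_2}z_3^{\gamma_3}z_4^{\gamma_4}$ of $p$ by $\mathcal B_\lambda(z_1)^{\gamma_1}\mathcal B_\lambda(z_2)^{\gamma_2}\mathcal B_\lambda(z_3)^{\gamma_3}\mathcal B_\lambda(z_4)^{\gamma_4}$ and $\bar q$ is obtained by conjugating the coefficients of $q$; it descends to $\mathcal F_\lambda$. $D_\alpha$ is the real Jordan superalgebra with even basis $e_1,e_2$, odd basis $\xi,\eta$ and supercommutative product $e_ie_i=e_i$, $e_1e_2=0$, $e_i\xi=\frac12\xi$, $e_i\eta=\frac12\eta$, $\xi\eta=e_1+\alpha e_2$. $L_a$ is left multiplication by $a$, $\mathrm{Der}(D_\alpha)$ the space of (super)derivations, $\mathfrak{str}(D_\alpha)=\{L_a\}\oplus\mathrm{Der}(D_\alpha)\subset\mathrm{End}(D_\alpha)$ with supercommutator bracket. $\mathfrak g=D_\alpha^-\oplus\mathfrak{str}(D_\alpha)\oplus D_\alpha^+$ with $D_\alpha^\pm$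 copies of $D_\alpha$ (write $a^\pm$), and brackets $[L_a,x^+]=(ax)^+$, $[D,x^+]=(Dx)^+$, $[L_a,u^-]=-(au)^-$, $[D,u^-]=(Du)^-$, $[x^+,u^-]=2L_{xu}+2[L_x,L_u]$, $[D_\alpha^\pm,D_\alpha^\pm]=0$ ($D\in\mathrm{Der}(D_\alpha)$). Let $a\mapsto z_a$ be the linear map with $e_1,e_2,\xi,\eta\mapsto z_1,z_2,z_3,z_4$, extend $\mathcal B_\lambda(z_a)$ linearly in $a$, and for $T\in\mathrm{End}(D_\alpha)$ let $\partial_T$ be the superderivation of $\mathcal P(\mathbb C^{2|2})$ (of the parity of $T$) with $\partial_T(z_b)=z_{T(b)}$. Put $\pi_\lambda(L_a)=\lambda(L_a)-\partial_{L_a}$, where $\lambda(2L_{e_1})=\lambda$, $\lambda(2L_{e_2})=\lambda/\alpha$, $\lambda(L_\xi)=\lambda(L_\eta)=0$ (extended linearly). The Fock representation is, for $a\in D_\alpha$, $D\in\mathrm{Der}(D_\alpha)$, $\rho_\lambda(a^-)=-\frac{\imath}{2}(z_a+\mathcal B_\lambda(z_a))+\imath\,\pi_\lambda(L_a)$, $\rho_\lambda(a^+)=-\frac{\imath}{2}(z_a+\mathcal B_\lambda(z_a))-\imath\,\pi_\lambda(L_a)$, $\rho_\lambda(2L_a)=z_a-\mathcal B_\lambda(z_a)$, $\rho_\lambda(D)=\partial_D$; it preserves $\mathcal I_\lambda$ and so acts on $\mathcal F_\lambda$. *)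

(* Defs.v *)
From HB Require Import structures.
From mathcomp Require Import all_boot all_order all_algebra.
From mathcomp Require Import ring_quotient.
From mathcomp Require Import ring.
From mathcomp Require Import boolp reals.
From mathcomp Require Import complex.
From mathcomp Require Import mpoly.

Set Implicit Arguments.
Unset Strict Implicit.
Unset Printing Implicit Defensive.

Import GRing.Theory.
Local Open Scope ring_scope.
Local Open Scope quotient_scope.

(* The indices 1, 2, 3, 4 of z_1, ..., z_4 and of the basis e_1, e_2, xi, eta *)
Definition i1 : 'I_4 := @Ordinal 4 0 isT.
Definition i2 : 'I_4 := @Ordinal 4 1 isT.
Definition i3 : 'I_4 := @Ordinal 4 2 isT.
Definition i4 : 'I_4 := @Ordinal 4 3 isT.

Definition par (i : 'I_4) : bool := (1 < i)%N.

Lemma ord4P (P : 'I_4 -> Prop) : P i1 -> P i2 -> P i3 -> P i4 -> forall i, P i.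
Proof.
move=> h1 h2 h3 h4 [[|[|[|[|//]]]] hi].
- by rewrite (_ : Ordinal hi = i1) //; apply: val_inj.
- by rewrite (_ : Ordinal hi = i2) //; apply: val_inj.
- by rewrite (_ : Ordinal hi = i3) //; apply: val_inj.
- by rewrite (_ : Ordinal hi = i4) //; apply: val_inj.
Qed.

Lemma big_ord4 (V : nmodType) (F : 'I_4 -> V) :
  \sum_i F i = F i1 + F i2 + F i3 + F i4.
Proof.
rewrite !big_ord_recl big_ord0 addr0 !addrA.
by congr (F _ + F _ + F _ + F _); apply: val_inj.
Qed.

Section SuperPolynomials.
Variable K : comNzRingType.

(* f (a, b) is the coefficient, in K[z_1, z_2], of z_3^a z_4^b *)
Definition superpoly := {ffun bool * bool -> {mpoly K[2]}}.
HB.instance Definition _ := GRing.Lmodule.on superpoly.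

Implicit Types (f g h : superpoly) (s u v : bool * bool).

(* z_3^a z_4^b z_3^c z_4^d = (-1)^(b c) z_3^(a + c) z_4^(b + d) *)
Definition sp_mul f g : superpoly := [ffun s : bool * bool =>
  \sum_(u : bool * bool) \sum_(v : bool * bool | (u.1 + v.1 == s.1)%N && (u.2 + v.2 == s.2)%N)
    (-1) ^+ (u.2 && v.1) * (f u * g v)].

Definition sp_inj s (p : {mpoly K[2]}) : superpoly :=
  [ffun t => if t == s then p else 0].

Definition sp_one : superpoly := sp_inj (false, false) 1.

Lemma sp_mulE f g s : sp_mul f g s =
  match s with
  | (false, false) => f (false, false) * g (false, false)
  | (true, false) => f (false, false) * g (true, false)
                     + f (true, false) * g (false, false)
  | (false, true) => f (false, false) * g (false, true)
                     + f (false, true) * g (false, false)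
  | (true, true) => f (false, false) * g (true, true)
                    + f (true, true) * g (false, false)
                    + f (true, false) * g (false, true)
                    - f (false, true) * g (true, false)
  end.
Proof.
rewrite ffunE; under eq_bigr do rewrite big_mkcond.
have sumbb (F : bool * bool -> {mpoly K[2]}) : \sum_u F u =
    F (true, true) + F (true, false) + (F (false, true) + F (false, false)).
  rewrite (eq_bigr (fun p => F (p.1, p.2))); last by case.
  by rewrite -(pair_bigA _ (fun a b => F (a, b))) /= !big_bool.
by rewrite !sumbb /=; case: s => [[] []] /=; rewrite ?expr0 ?expr1; ring.
Qed.

Lemma sp_addE f g s : (f + g) s = f s + g s. Proof. exact: ffunE. Qed.

Lemma sp_scaleE (c : K) f s : (c *: f) s = c%:MP * f s.
Proof. by rewrite ffunE mul_mpolyC. Qed.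

Fact sp_mulA : associative sp_mul.
Proof. by move=> f g h; apply/ffunP => -[[] []]; rewrite !sp_mulE; ring. Qed.

Fact sp_mul1l : left_id sp_one sp_mul.
Proof. by move=> f; apply/ffunP => -[[] []]; rewrite !sp_mulE !ffunE /=; ring. Qed.

Fact sp_mul1r : right_id sp_one sp_mul.
Proof. by move=> f; apply/ffunP => -[[] []]; rewrite !sp_mulE !ffunE /=; ring. Qed.

Fact sp_mulDl : left_distributive sp_mul +%R.
Proof. by move=> f g h; apply/ffunP => -[[] []]; rewrite ?(sp_addE, sp_mulE); ring. Qed.

Fact sp_mulDr : right_distributive sp_mul +%R.
Proof. by move=> f g h; apply/ffunP => -[[] []]; rewrite ?(sp_addE, sp_mulE); ring. Qed.

Fact sp_one_neq0 : sp_one != 0.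
Proof. by apply/eqP => /ffunP /(_ (false, false)); rewrite !ffunE /=; apply/eqP/oner_neq0. Qed.

HB.instance Definition _ := GRing.Zmodule_isNzRing.Build superpoly
  sp_mulA sp_mul1l sp_mul1r sp_mulDl sp_mulDr sp_one_neq0.

Lemma spME f g s : (f * g) s = sp_mul f g s. Proof. by []. Qed.

Fact sp_scaleAl (c : K) f g : c *: (f * g) = (c *: f) * g.
Proof.
by apply/ffunP => -[[] []];
  rewrite ?(sp_scaleE, spME, sp_mulE); ring.
Qed.

HB.instance Definition _ := GRing.Lmodule_isLalgebra.Build K superpoly sp_scaleAl.

Fact sp_scaleAr (c : K) f g : c *: (f * g) = f * (c *: g).
Proof.
by apply/ffunP => -[[] []];
  rewrite ?(sp_scaleE, spME, sp_mulE); ring.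
Qed.

HB.instance Definition _ := GRing.Lalgebra_isAlgebra.Build K superpoly sp_scaleAr.

Definition sp_homog (k : bool) f := forall s, s.1 (+) s.2 != k -> f s = 0.

Definition zvar (i : 'I_4) : superpoly :=
  match val i with
  | 0%N => sp_inj (false, false) 'X_ord0
  | 1%N => sp_inj (false, false) 'X_ord_max
  | 2%N => sp_inj (true, false) 1
  | _ => sp_inj (false, true) 1
  end.

(* the sign in the last case is that of moving the left derivative past z_3 *)
Definition pd (i : 'I_4) f : superpoly :=
  match val i with
  | 0%N => [ffun s => (f s)^`M(ord0)]
  | 1%N => [ffun s => (f s)^`M(ord_max)]
  | 2%N => [ffun s => if s.1 then 0 else f (true, s.2)]
  | _ => [ffun s : bool * bool => if s.2 then 0 else (-1) ^+ s.1 * f (s.1, true)]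
  end.

Lemma pdE i f (s : bool * bool) : pd i f s =
  match val i with
  | 0%N => (f s)^`M(ord0)
  | 1%N => (f s)^`M(ord_max)
  | 2%N => if s.1 then 0 else f (true, s.2)
  | _ => if s.2 then 0 else (-1) ^+ s.1 * f (s.1, true)
  end.
Proof. by move: i; apply: ord4P; rewrite /pd /= ffunE. Qed.

Lemma sp_supercomm k l f g : sp_homog k f -> sp_homog l g ->
  f * g = (-1) ^+ (k && l) * (g * f).
Proof.
have sgE (b : bool) (x : superpoly) : (-1) ^+ b * x = (-1) ^+ b *: x.
  by case: b; rewrite ?expr0 ?expr1 ?mul1r ?scale1r ?mulN1r ?scaleN1r.
move=> hf hg; rewrite sgE; apply/ffunP => s; rewrite sp_scaleE !spME !sp_mulE.
have f0 := hf (false, false); have f1 := hf (true, false).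
have f2 := hf (false, true); have f3 := hf (true, true).
have g0 := hg (false, false); have g1 := hg (true, false).
have g2 := hg (false, true); have g3 := hg (true, true).
by case: s k l f0 f1 f2 f3 g0 g1 g2 g3 {hf hg} => [[] []] [] [] /= f0 f1 f2 f3 g0 g1 g2 g3;
  rewrite ?(f0 isT) ?(f1 isT) ?(f2 isT) ?(f3 isT) ?(g0 isT) ?(g1 isT) ?(g2 isT) ?(g3 isT)
   ?expr0 ?expr1 ?mpolyCN ?mpolyC1; ring.
Qed.

Lemma pd_zvar i j : pd i (zvar j) = (i == j)%:R.
Proof.
have nat1 : (true%:R : superpoly) = sp_one by [].
move: i j; do 2 (apply: ord4P); apply/ffunP => -[[] []];
  rewrite /= /pd ?nat1 ?mulr0n /zvar /= /sp_one /sp_inj ?ffunE /= ?ffunE /=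
    ?mderivX ?mderivC ?mderiv0 ?expr0 ?expr1 ?mul1r ?mulr0 //.
all: by rewrite mnm1E /= ?scale0r // scale1r (_ : (_ - _)%MM = 0%MM) ?mpolyX0 //;
  apply/mnmP => a; rewrite mnmBE subnn mnmE.
Qed.

Lemma pd_superderivation i k f g : sp_homog k f ->
  pd i (f * g) = pd i f * g + (-1) ^+ (par i && k) * (f * pd i g).
Proof.
have sgE (b : bool) (x : superpoly) : (-1) ^+ b * x = (-1) ^+ b *: x.
  by case: b; rewrite ?expr0 ?expr1 ?mul1r ?scale1r ?mulN1r ?scaleN1r.
move=> hf; rewrite sgE; apply/ffunP => s; rewrite sp_addE sp_scaleE !spME.
have f0 := hf (false, false); have f1 := hf (true, false).
have f2 := hf (false, true); have f3 := hf (true, true).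
move: i; apply: ord4P;
 case: s k f0 f1 f2 f3 {hf} => [[] []] [] /= f0 f1 f2 f3;
  rewrite ?(pdE, spME, sp_mulE) /= ?(mderivD, mderivN, mderivM)
   ?(f0 isT) ?(f1 isT) ?(f2 isT) ?(f3 isT)
   ?mderiv0 ?expr0 ?expr1 ?mpolyCN ?mpolyC1; ring.
Qed.

End SuperPolynomials.

Section JordanSuperalgebra.
Variables (R : realType) (alpha : R).

Local Notation D := 'rV[R]_4.
Implicit Types (a b c x u : D) (S T : 'End(D)) (k l i j : bool).

(* product in coordinates on the basis e_1, e_2, xi, eta; see jmul_table *)
Definition jmul a b : D :=
  let w := a 0 i3 * b 0 i4 - a 0 i4 * b 0 i3 in
  \row_m match val m with
         | 0%N => a 0 i1 * b 0 i1 + w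
         | 1%N => a 0 i2 * b 0 i2 + alpha * w
         | _ => 2^-1 * ((a 0 i1 + a 0 i2) * b 0 m + a 0 m * (b 0 i1 + b 0 i2))
         end.

Definition jbasis (m : 'I_4) : D := delta_mx 0 m.

Lemma rV4P a b : a 0 i1 = b 0 i1 -> a 0 i2 = b 0 i2 ->
  a 0 i3 = b 0 i3 -> a 0 i4 = b 0 i4 -> a = b.
Proof. by move=> h1 h2 h3 h4; apply/rowP; apply: ord4P. Qed.

Lemma jmul_table :
  let e1 := jbasis i1 in let e2 := jbasis i2 in
  let xi := jbasis i3 in let eta := jbasis i4 in
  [/\ [/\ jmul e1 e1 = e1, jmul e2 e2 = e2, jmul e1 e2 = 0 & jmul e2 e1 = 0],
      [/\ jmul e1 xi = 2^-1 *: xi, jmul e1 eta = 2^-1 *: eta,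
          jmul e2 xi = 2^-1 *: xi & jmul e2 eta = 2^-1 *: eta],
      [/\ jmul xi e1 = 2^-1 *: xi, jmul eta e1 = 2^-1 *: eta,
          jmul xi e2 = 2^-1 *: xi & jmul eta e2 = 2^-1 *: eta] &
      [/\ jmul xi eta = e1 + alpha *: e2, jmul eta xi = - (e1 + alpha *: e2),
          jmul xi xi = 0 & jmul eta eta = 0]].
Proof. split; split; apply: rV4P; rewrite !mxE /=; ring. Qed.

Fact jmul_is_linear a : linear (jmul a).
Proof. by move=> t b c; apply: rV4P; rewrite !mxE /=; ring. Qed.
HB.instance Definition _ a := GRing.isLinear.Build R D D _ (jmul a) (jmul_is_linear a).

Definition L a : 'End(D) := linfun (jmul a).

(* homogeneous component of parity k: false is even, true is odd *)
Definition jpart k a : D := \row_m (if par m == k then a 0 m else 0).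

Fact jpart_is_linear k : linear (jpart k).
Proof. by move=> t a b; apply/rowP => m; rewrite !mxE; case: ifP => _; ring. Qed.
HB.instance Definition _ k := GRing.isLinear.Build R D D _ (jpart k) (jpart_is_linear k).

Definition jhomog k a := jpart k a = a.

(* component of parity k of an endomorphism *)
Definition epart k T : 'End(D) :=
  \sum_(j : bool) (linfun (jpart (j (+) k)) \o T \o linfun (jpart j))%VF.

Definition ehomog k T := epart k T = T.

(* for T of parity k *)
Definition is_superderivation k T := forall i a b, jhomog i a ->
  T (jmul a b) = jmul (T a) b + (-1) ^+ (k && i) *: jmul a (T b).

Definition der_pred : {pred 'End(D)} :=
  fun T => `[< forall k, is_superderivation k (epart k T) >].

Lemma epartE k T a : epart k T a = \sum_(j : bool) jpart (j (+) k) (T (jpart j a)).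
Proof. by rewrite sum_lfunE; apply: eq_bigr => j _; rewrite !comp_lfunE !lfunE. Qed.

Fact epart_is_linear k : linear (epart k).
Proof.
move=> t S T; apply/lfunP => a; rewrite add_lfunE scale_lfunE !epartE scaler_sumr.
by rewrite -big_split; apply: eq_bigr => j _; rewrite /= add_lfunE scale_lfunE linearP.
Qed.
HB.instance Definition _ k :=
  GRing.isLinear.Build R 'End(D) 'End(D) _ (epart k) (epart_is_linear k).

Lemma jpartK k l a : jpart k (jpart l a) = if k == l then jpart k a else 0.
Proof.
apply/rowP => m; rewrite (fun_if (fun c : D => c 0 m)) !mxE.
by case: k l (par m) => [] [] [].
Qed.

Lemma jpart_sum a : jpart false a + jpart true a = a.
Proof. by apply/rowP => m; rewrite !mxE; case: (par m); rewrite ?add0r ?addr0. Qed.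

Lemma jmulDl a b c : jmul (a + b) c = jmul a c + jmul b c.
Proof. by apply: rV4P; rewrite !mxE /=; ring. Qed.

Lemma jmulZl t a c : jmul (t *: a) c = t *: jmul a c.
Proof. by apply: rV4P; rewrite !mxE /=; ring. Qed.

Lemma jmul0l c : jmul 0 c = 0.
Proof. by rewrite -[X in jmul X](scale0r 0) jmulZl scale0r. Qed.

Lemma jmulNl a c : jmul (- a) c = - jmul a c.
Proof. by rewrite -scaleN1r jmulZl scaleN1r. Qed.

Lemma jmulNr a c : jmul a (- c) = - jmul a c.
Proof. exact: linearN. Qed.

Lemma epart_sum T : epart false T + epart true T = T.
Proof.
apply/lfunP => a; rewrite add_lfunE !epartE !big_bool /=.
rewrite addrACA [X in X + _]addrC !jpart_sum -linearD addrC /= addrC.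
by rewrite addrC jpart_sum.
Qed.

Lemma epartK k l T : epart k (epart l T) = if k == l then epart k T else 0.
Proof.
apply/lfunP => a; rewrite epartE !big_bool /= !epartE !big_bool /=.
rewrite !linearD /= !jpartK /=.
by case: k l => [] []; rewrite /= ?linear0 ?addr0 ?add0r ?zero_lfunE ?epartE ?big_bool.
Qed.

Fact der_pred_closed : submod_closed der_pred.
Proof.
split.
  apply/asboolP => k i a b _.
  by rewrite linear0 !zero_lfunE linear0 jmul0l scaler0 addr0.
move=> t S T /asboolP hS /asboolP hT; apply/asboolP => k i a b ha.
rewrite linearP !add_lfunE !scale_lfunE (hS k i) // (hT k i) //.
by rewrite jmulDl jmulZl linearP !scalerDr !scalerA [t * _]mulrC addrACA.
Qed.

HB.instance Definition _ :=
  GRing.isSubmodClosed.Build R 'End(D) der_pred der_pred_closed.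

Record der := Der { der_val :> 'End(D); der_valP : der_val \in der_pred }.
HB.instance Definition _ := [isSub for der_val].
HB.instance Definition _ := [Choice of der by <:].
HB.instance Definition _ := [SubChoice_isSubLmodule of der by <:].

(* ST - (-1)^(|S||T|) TS, extended bilinearly *)
Definition scomm S T : 'End(D) := \sum_(i : bool) \sum_(j : bool)
  ((epart i S \o epart j T)%VF - (-1) ^+ (i && j) *: (epart j T \o epart i S)%VF).

Lemma jpart_homog i a : jhomog i (jpart i a).
Proof. by rewrite /jhomog jpartK eqxx. Qed.

Lemma epart_homog i T : ehomog i (epart i T).
Proof. by rewrite /ehomog epartK eqxx. Qed.

Lemma ehomog_app k i T a : ehomog k T -> jhomog i a -> jhomog (k (+) i) (T a).
Proof.
rewrite /jhomog => <- <-; rewrite epartE big_bool /=.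
by case: k i => [] []; rewrite !jpartK /= ?linear0 ?add0r ?addr0 jpartK.
Qed.

Lemma der_of_homog k T : ehomog k T -> is_superderivation k T -> T \in der_pred.
Proof.
move=> hT dT; apply/asboolP => l i a b ha; rewrite -hT epartK.
case: eqP => [->|_]; first by rewrite hT; apply: dT.
by rewrite !zero_lfunE linear0 jmul0l scaler0 addr0.
Qed.

Lemma ehomog_comp k l S T : ehomog k S -> ehomog l T -> ehomog (k (+) l) (S \o T)%VF.
Proof.
move=> hS hT; apply/lfunP => a; rewrite epartE big_bool /= comp_lfunE.
rewrite -{3}(jpart_sum a) !linearD /= !comp_lfunE addrC.
have h i : jpart (i (+) (k (+) l)) (S (T (jpart i a))) = S (T (jpart i a)).
  rewrite addbC -addbA; apply: ehomog_app => //; apply: ehomog_app => //.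
  exact: jpart_homog.
by congr (_ + _); [apply: (h false)|apply: (h true)].
Qed.

Lemma scomm_homog_der i j S T :
    ehomog i S -> ehomog j T -> is_superderivation i S -> is_superderivation j T ->
  (S \o T)%VF - (-1) ^+ (i && j) *: (T \o S)%VF \in der_pred.
Proof.
move=> hS hT dS dT; apply: (@der_of_homog (i (+) j)).
  rewrite /ehomog linearB linearZ /= ehomog_comp //.
  by rewrite [i (+) j]addbC ehomog_comp.
move=> k a b ha.
rewrite !(add_lfunE, opp_lfunE, scale_lfunE, comp_lfunE).
rewrite (dS _ _ _ ha) (dT _ _ _ ha) !linearD !linearZ /=.
have hSa := ehomog_app hS ha; have hTa := ehomog_app hT ha.
rewrite (dS _ _ _ ha) (dT _ _ _ ha) (dS _ _ _ hTa) (dT _ _ _ hSa).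
rewrite jmulDl jmulZl jmulNl jmulNr.
apply/rowP => m; move: jmul => mul; rewrite !mxE.
case: i j k {hS hT dS dT ha hSa hTa} => [] [] []; rewrite /= ?expr0 ?expr1; ring.
Qed.

Lemma ders_scomm S T : S \in der_pred -> T \in der_pred -> scomm S T \in der_pred.
Proof.
move=> /asboolP dS /asboolP dT; apply: rpred_sum => i _; apply: rpred_sum => j _.
by apply: scomm_homog_der; [apply: epart_homog|apply: epart_homog|exact: dS|exact: dT].
Qed.

Lemma L_linear : linear L.
Proof.
by move=> t a b; apply/lfunP => c; rewrite add_lfunE scale_lfunE !lfunE /= jmulDl jmulZl.
Qed.

Lemma epart_L k a : epart k (L a) = L (jpart k a).
Proof.
apply/lfunP => c; rewrite epartE big_bool /= !lfunE /=.
by case: k; apply: rV4P; rewrite !mxE /=; ring.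
Qed.

Definition jev (x y : R) : D := \row_m match val m with 0%N => x | 1%N => y | _ => 0 end.
Definition jod (x y : R) : D :=
  \row_m match val m with 2%N => x | 3%N => y | _ => 0 end.

Lemma jpart0E a : jpart false a = jev (a 0 i1) (a 0 i2).
Proof. by apply: rV4P; rewrite !mxE. Qed.

Lemma jpart1E a : jpart true a = jod (a 0 i3) (a 0 i4).
Proof. by apply: rV4P; rewrite !mxE. Qed.

Lemma jmul_ee (x y s t : R) : jmul (jev x y) (jev s t) = jev (x * s) (y * t).
Proof. by apply: rV4P; rewrite !mxE /=; ring. Qed.

Lemma jmul_eo (x y s t : R) :
  jmul (jev x y) (jod s t) = jod (2^-1 * (x + y) * s) (2^-1 * (x + y) * t).
Proof. by apply: rV4P; rewrite !mxE /=; ring. Qed.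

Lemma jmul_oe (x y s t : R) :
  jmul (jod s t) (jev x y) = jod (2^-1 * (x + y) * s) (2^-1 * (x + y) * t).
Proof. by apply: rV4P; rewrite !mxE /=; ring. Qed.

Lemma jmul_oo (x y s t : R) :
  jmul (jod x y) (jod s t) = jev (x * t - y * s) (alpha * (x * t - y * s)).
Proof. by apply: rV4P; rewrite !mxE /=; ring. Qed.

Lemma jev_comb (r x y s t : R) :
  (jev x y + r *: jev s t = jev (x + r * s) (y + r * t)) *
  (jev x y - r *: jev s t = jev (x - r * s) (y - r * t)).
Proof. by split; apply: rV4P; rewrite !mxE /=; ring. Qed.

Lemma jod_comb (r x y s t : R) :
  (jod x y + r *: jod s t = jod (x + r * s) (y + r * t)) *
  (jod x y - r *: jod s t = jod (x - r * s) (y - r * t)).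
Proof. by split; apply: rV4P; rewrite !mxE /=; ring. Qed.

Definition jmul_hE := (jmul_ee, jmul_eo, jmul_oe, jmul_oo, jev_comb, jod_comb).

Lemma inner_der a b : scomm (L a) (L b) \in der_pred.
Proof.
apply: rpred_sum => i _; apply: rpred_sum => j _; rewrite !epart_L.
apply: (@der_of_homog (i (+) j)).
  have h k c : ehomog k (L (jpart k c)) by rewrite /ehomog epart_L jpartK eqxx.
  rewrite /ehomog linearB linearZ /= ehomog_comp //.
  by rewrite [i (+) j]addbC ehomog_comp.
move=> k c d <-; set K := (_ - _); rewrite -(jpart_sum d) !linearD /=.
suff h l : K (jmul (jpart k c) (jpart l d)) = jmul (K (jpart k c)) (jpart l d)
    + (-1) ^+ ((i (+) j) && k) *: jmul (jpart k c) (K (jpart l d)).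
  by rewrite !h addrACA.
rewrite {}/K !(add_lfunE, opp_lfunE, scale_lfunE, comp_lfunE) !lfunE /=.
by case: i j k l => [] [] [] []; rewrite !(jpart0E, jpart1E) !jmul_hE;
   congr (_ _ _); field.
Qed.

Lemma L_der_direct a : L a \in der_pred -> a = 0.
Proof.
move=> /asboolP dL; pose o := jev 1 1.
have ho : jhomog false o by rewrite /jhomog jpart0E /o !mxE.
have oM b : jmul o b = b by apply: rV4P; rewrite !mxE /=; field.
have Mo b : jmul b o = b by apply: rV4P; rewrite !mxE /=; field.
have h k : jpart k a = 0.
  have := dL k false o o ho; rewrite epart_L !lfunE /= oM !Mo andbF expr0 scale1r.
  by rewrite oM => /eqP; rewrite -subr_eq subrr => /eqP.
by rewrite -(jpart_sum a) !h addr0.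
Qed.

End JordanSuperalgebra.

Section TKK.
Variables (R : realType) (alpha : R).

Local Notation D := 'rV[R]_4.
Local Notation der := (der alpha).
Implicit Types (a b u x : D) (T : 'End(D)).

(* D^- (+) ({L_a} (+) Der) (+) D^+: the tuple (u, (a, T), x) stands for
   u^- + (L_a + T) + x^+; by L_der_direct, L_a + T determines a and T *)
Definition tkk : Type := (D * (D * der) * D)%type.
HB.instance Definition _ := GRing.Lmodule.on tkk.

Definition tkk_homog k (X : tkk) : Prop :=
  let: (u, (a, T), x) := X in
  [/\ jhomog k u, jhomog k a, ehomog k T & jhomog k x].

(* (-1)^(|T||u|) T u, extended bilinearly; thus [u, T] = - der_right T u *)
Definition der_right T u : D := \sum_(i : bool) \sum_(j : bool)
  (-1) ^+ (i && j) *: epart i T (jpart j u).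

Definition inner a b : der := Der (inner_der alpha a b).
Definition der_comm (E F : der) : der := Der (ders_scomm (der_valP E) (der_valP F)).

(* The components of the bracket use the supersymmetry of the bracket together
   with the supercommutativity of jmul, e.g. [u^-, L_b] = (ub)^- and
   [u^-, y^+] = - 2 L_(uy) + 2 [L_u, L_y] *)
Definition tkk_bracket (X Y : tkk) : tkk :=
  let: (u, (a, E), x) := X in
  let: (v, (b, F), y) := Y in
  (- jmul alpha a v + der_val E v + jmul alpha u b - der_right F u,
   (der_val E b - der_right F a + 2 *: jmul alpha x v - 2 *: jmul alpha u y,
    der_comm E F + inner a b + 2 *: inner x v + 2 *: inner u y),
   jmul alpha a y + der_val E y - jmul alpha x b - der_right F x).

End TKK.

Section Bessel.
Variables (K : fieldType) (al lam : K).
Local Notation P := (superpoly K).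
Local Notation z1 := (zvar K i1).
Local Notation z2 := (zvar K i2).
Local Notation z3 := (zvar K i3).
Local Notation z4 := (zvar K i4).
Local Notation "'d1" := (@pd K i1).
Local Notation "'d2" := (@pd K i2).
Local Notation "'d3" := (@pd K i3).
Local Notation "'d4" := (@pd K i4).

Definition bessel (m : 'I_4) (f : P) : P :=
  match val m with
  | 0%N => - lam *: 'd1 f + z1 * 'd1 ('d1 f) + z3 * 'd3 ('d1 f) + z4 * 'd4 ('d1 f)
           - (2 * al) *: (z2 * 'd3 ('d4 f))
  | 1%N => - (lam / al) *: 'd2 f + z2 * 'd2 ('d2 f) + z3 * 'd3 ('d2 f)
           + z4 * 'd4 ('d2 f) - 2 *: (z1 * 'd3 ('d4 f))
  | 2%N => - (2 * lam) *: 'd4 f + 2 *: (z1 * 'd1 ('d4 f))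
           + (2 * al) *: (z2 * 'd2 ('d4 f))
           + (2 * (1 + al)) *: (z3 * 'd3 ('d4 f)) + z3 * 'd1 ('d2 f)
  | _ => (2 * lam) *: 'd3 f - 2 *: (z1 * 'd1 ('d3 f))
         - (2 * al) *: (z2 * 'd2 ('d3 f))
         - (2 * (1 + al)) *: (z4 * 'd4 ('d3 f)) + z4 * 'd1 ('d2 f)
  end.

(* p(B_lambda) g *)
Definition bessel_subst (p g : P) : P :=
  \sum_(s : bool * bool) \sum_(m <- msupp (p s))
    (p s)@_m *: iter (m ord0) (bessel i1) (iter (m ord_max) (bessel i2)
                  (iter s.1 (bessel i3) (iter s.2 (bessel i4) g))).

Definition eval0 (f : P) : K := (f (false, false))@_0%MM.

End Bessel.

Definition ideal_gen (A : nzRingType) (gs : seq A) : {pred A} := fun f =>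
  `[< exists2 t : seq (A * A * A), {in t, forall w, w.1.2 \in gs}
        & f = \sum_(w <- t) w.1.1 * w.1.2 * w.2 >].

Fact ideal_gen_zmod (A : nzRingType) (gs : seq A) : zmod_closed (ideal_gen gs).
Proof.
split; first by apply/asboolP; exists [::] => //; rewrite big_nil.
move=> f g /asboolP[t ht ->] /asboolP[r hr ->]; apply/asboolP.
exists (t ++ [seq (- w.1.1, w.1.2, w.2) | w <- r]).
  move=> w; rewrite mem_cat => /orP[/ht //|/mapP[v /hr hv ->]]; exact: hv.
rewrite big_cat big_map -sumrN; congr (_ + _).
by apply: eq_bigr => w _; rewrite !mulNr.
Qed.

HB.instance Definition _ (A : nzRingType) (gs : seq A) :=
  GRing.isZmodClosed.Build A (ideal_gen gs) (ideal_gen_zmod gs).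

Section Fock.
Variables (R : realType) (alpha lam : R).

Local Notation D := 'rV[R]_4.
Local Notation C := R[i].
Local Notation P := (superpoly C).
Local Notation "x %:C" := (real_complex R x).
Local Notation z m := (zvar C m).
Local Notation B := (bessel alpha%:C lam%:C).
Implicit Types (a u x : D) (T : 'End(D)) (f g : P).

(* only used for lam = alpha and lam = 1 *)
Definition fock_gens : seq P :=
  if lam == alpha then
    [:: 2 *: (z i1 * z i2) + z i3 * z i4; z i2 ^+ 2; z i2 * z i3; z i2 * z i4]
  else
    [:: (2 * alpha%:C) *: (z i1 * z i2) + z i3 * z i4;
        z i1 ^+ 2; z i1 * z i3; z i1 * z i4].

Definition fock_ideal : {pred P} := ideal_gen fock_gens.
HB.instance Definition _ := GRing.ZmodClosed.on fock_ideal.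

Definition fock := Quotient.quot fock_ideal.
HB.instance Definition _ := GRing.Zmodule.on fock.

Fact fock_idealZ (c : C) f : f \in fock_ideal -> c *: f \in fock_ideal.
Proof.
move=> /asboolP[t ht ->]; apply/asboolP; exists [seq (c *: w.1.1, w.1.2, w.2) | w <- t].
  by move=> w /mapP[v /ht hv ->].
by rewrite big_map scaler_sumr; apply: eq_bigr => w _ /=; rewrite !scalerAl.
Qed.

Definition fock_scale (c : C) (p : fock) : fock := \pi_fock (c *: repr p).

Lemma fock_eq f g : (f - g \in fock_ideal) = (\pi_fock f == \pi_fock g).
Proof. exact: Quotient.idealrBE. Qed.

Fact pi_scale (c : C) f : \pi_fock (c *: f) = fock_scale c (\pi_fock f).
Proof.
apply/eqP; rewrite -fock_eq -scalerBr; apply: fock_idealZ.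
by rewrite fock_eq reprK.
Qed.

Fact pi_add f g : \pi_fock (f + g) = \pi_fock f + \pi_fock g.
Proof. exact: raddfD. Qed.

Implicit Types p q : fock.

Fact fock_scaleA (b c : C) p : fock_scale b (fock_scale c p) = fock_scale (b * c) p.
Proof.
rewrite -(reprK p); move: (repr p) => f.
by rewrite -(pi_scale c) -(pi_scale b) -(pi_scale (b * c)) scalerA.
Qed.

Fact fock_scale1 p : fock_scale 1 p = p.
Proof. by rewrite -(reprK p); move: (repr p) => f; rewrite -(pi_scale 1) scale1r. Qed.

Fact fock_scaleDr (c : C) p q : fock_scale c (p + q) = fock_scale c p + fock_scale c q.
Proof.
rewrite -(reprK p) -(reprK q); move: (repr p) (repr q) => f g.
by rewrite -pi_add -(pi_scale c (f + g)) -(pi_scale c f) -(pi_scale c g) -pi_add scalerDr.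
Qed.

Fact fock_scaleDl p (b c : C) : fock_scale (b + c) p = fock_scale b p + fock_scale c p.
Proof.
rewrite -(reprK p); move: (repr p) => f.
by rewrite -(pi_scale (b + c) f) -(pi_scale b f) -(pi_scale c f) -pi_add scalerDl.
Qed.

HB.instance Definition _ := GRing.Zmodule_isLmodule.Build C fock
  fock_scaleA fock_scale1 fock_scaleDr fock_scaleDl.

Definition fock_homog (k : bool) (p : fock) : Prop :=
  exists2 f : P, sp_homog k f & p = \pi_fock f.

Definition sp_conj (q : P) : P := [ffun s => map_mpoly Num.conj (q s)].

Definition bessel_fischer (p q : P) : C :=
  eval0 (bessel_subst alpha%:C lam%:C p (sp_conj q)).

Definition zlin a : P := \sum_m (a 0 m)%:C *: z m.
Definition bessel_lin a f : P := \sum_m (a 0 m)%:C *: B m f.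

(* characterised by pdT_zvar and pdT_superderivation *)
Definition pdT T f : P := \sum_m zlin (T (jbasis R m)) * pd m f.

Lemma pdT_zvar T m : pdT T (z m) = zlin (T (jbasis R m)).
Proof.
rewrite /pdT (bigD1 m) //= pd_zvar eqxx mulr1 big1 ?addr0 // => n /negPf nm.
by rewrite pd_zvar nm mulr0.
Qed.

Lemma zlin_homog k a : jhomog k a -> sp_homog k (zlin a).
Proof.
move=> ha s hs; rewrite sum_ffunE big1 // => m _; rewrite -ha mxE.
case: eqP => [hm|_]; last by rewrite ffunE scale0r.
move: m s hs hm; apply: ord4P => -[[] []] /=; case: k {ha} => //= _ _;
  by rewrite !ffunE /= scaler0.
Qed.

Lemma pdT_superderivation k l T f g : ehomog k T -> sp_homog l f ->
  pdT T (f * g) = pdT T f * g + (-1) ^+ (k && l) * (f * pdT T g).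
Proof.
move=> hT hf; rewrite /pdT mulr_suml !mulr_sumr -big_split; apply: eq_bigr => m _ /=.
rewrite (pd_superderivation m g hf); set w := zlin _; set d := pd m f; set e := pd m g.
have hm : sp_homog (k (+) par m) w.
  apply: zlin_homog; apply: ehomog_app => //.
  apply/rowP => n; rewrite !mxE eqxx /=.
  by case: (eqVneq n m) => [->|_]; rewrite ?eqxx ?if_same.
have sgC (b : bool) (h h' : P) : h * ((-1) ^+ b * h') = (-1) ^+ b * (h * h').
  by case: b; rewrite ?expr0 ?expr1 ?mul1r ?mulN1r ?mulrN.
have /eqP := sp_supercomm hm hf; move: w d e {hm} => w d e /eqP wf.
rewrite mulrDr sgC (mulrA w f e) wf -!mulrA [_ ^+ _ * (_ ^+ _ * _)]mulrA -signr_addb.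
by congr (_ + _ ^+ _ * _); case: k (par m) l {hT hf wf} => [] [] [].
Qed.

(* the functional with 2 L_(e_1) |-> lam, 2 L_(e_2) |-> lam / alpha, L_xi, L_eta |-> 0 *)
Definition lamL a : R := 2^-1 * (lam * a 0 i1 + lam / alpha * a 0 i2).

Definition pi_L a f : P := (lamL a)%:C *: f - pdT (L alpha a) f.

Definition rho_minus u f : P :=
  - ('i / 2) *: (zlin u * f + bessel_lin u f) + 'i *: pi_L u f.
Definition rho_plus x f : P :=
  - ('i / 2) *: (zlin x * f + bessel_lin x f) - 'i *: pi_L x f.
Definition rho_L a f : P := 2^-1 *: (zlin a * f - bessel_lin a f).

Definition rho (X : tkk alpha) f : P :=
  let: (u, (a, T), x) := X in
  rho_minus u f + rho_L a f + pdT T f + rho_plus x f.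

(* Both the action of rho and the Bessel-Fischer product descend to the quotient:
   they are computed on representatives *)
Definition fock_act (X : tkk alpha) (p : fock) : fock := \pi_fock (rho X (repr p)).

Definition fock_product (p q : fock) : C := bessel_fischer (repr p) (repr q).

End Fock.

(* Main.v *)
Require Import Defs.
From HB Require Import structures.
From mathcomp Require Import all_boot all_order all_algebra.
From mathcomp Require Import ring lra.
From mathcomp Require Import boolp reals.
From mathcomp Require Import complex.
From mathcomp Require Import ssrcomplements mpoly.

(** Write [form p g] for the bilinear version of the Bessel-Fischer product: the
value at 0 of p(B) g, where p(B) substitutes the Bessel operators for the
variables; the product itself is [form p (conj q)].  Everything rests on
adjoints: [adjoint S S'] says that <p, S g> = <S' p, g> for all p and g.

The Bessel operators supercommute, hence p |-> p(B) is an algebra morphism and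
<p z_b, g> = <p, B_b g>: the adjoint of B_b is right multiplication by z_b
([adjoint_bessel]), that is, left multiplication by z_b after the parity
involution when z_b is odd.  All the other adjoints come from one induction on p
([adjoint_comm]).  With p = p' z_b,
   <p' z_b, S g> = <p', B_b (S g)> = +- <p', S (B_b g)> + <p', [B_b, S] g>,
so the adjoint of S is determined as soon as that of the supercommutator [B_b, S]
is known.  It is applied twice.
 - If S is the linear vector field given by an element of the
   structure algebra str(D_alpha), then [B_b, S] is a combination of Bessel
   operators; this gives [adjoint_str_even] and [adjoint_str_odd]: multiplication
   operators L_a are self-adjoint and derivations are anti-self-adjoint.
 - If S is multiplication by z_a, then [B_b, z_a] is an element of the structure
   algebra plus a constant, whose adjoint has just been found; this gives
   [adjoint_zvar]: the adjoint of z_a is B_a, up to the parity involution.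

The operators rho(X) are combinations of z_a, B_a, pi(L_a) and of the vector
fields of derivations, arranged so that, the coefficients i being conjugated in the
second argument, the product changes sign ([skew_rho]).

Finally the product is computed on representatives.  The ideal is contained in an
explicit space of superpolynomials ([fock_shape]) which vanish at 0 and which is
stable under the Bessel operators, the parity involution and conjugation.  Such a
space lies in both radicals of the form: <p, f> vanishes because p(B) f still
belongs to the space ([form_radicalr]), and <f, g> vanishes because g can be moved
to the left as a product of Bessel operators ([form_radicall]).  Hence neither the
choice of representatives nor the inhomogeneous part that they may have matters.

The identities between operators are checked on the four components of a
superpolynomial in the basis 1, z_3, z_4, z_3 z_4 of the exterior algebra, where
they become identities of commutative algebra in polynomials and their formal
derivatives. *)

Set Implicit Arguments.
Unset Strict Implicit.
Unset Printing Implicit Defensive.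

Import GRing.Theory Num.Theory.
Local Open Scope ring_scope.
Local Open Scope quotient_scope.

Local Arguments bessel : simpl never.
Local Arguments zvar : simpl never.

(** * Superpolynomials by components *)
Section Components.
Variable K : comNzRingType.
Local Notation P := (superpoly K).
Local Notation A := {mpoly K[2]}.
Local Notation x := ('X_ord0 : A).
Local Notation y := ('X_ord_max : A).
Local Notation d1 := (mderiv (ord0 : 'I_2)).
Local Notation d2 := (mderiv (ord_max : 'I_2)).

(** The superpolynomial a + b z_3 + c z_4 + d z_3 z_4. *)
Definition sp4 (a b c d : A) : P := [ffun s : bool * bool =>
  match s with (false, false) => a | (true, false) => b
  | (false, true) => c | (true, true) => d end].

Lemma sp4K (f : P) :
  f = sp4 (f (false, false)) (f (true, false)) (f (false, true)) (f (true, true)).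
Proof. by apply/ffunP => -[[] []]; rewrite ffunE. Qed.

Lemma sp4_ind (Q : P -> Prop) : (forall a b c d, Q (sp4 a b c d)) -> forall f, Q f.
Proof. by move=> h f; rewrite (sp4K f). Qed.

Lemma sp4_eq a b c d a' b' c' d' :
  a = a' -> b = b' -> c = c' -> d = d' -> sp4 a b c d = sp4 a' b' c' d'.
Proof. by move=> -> -> -> ->. Qed.

Lemma sp4D a b c d a' b' c' d' :
  sp4 a b c d + sp4 a' b' c' d' = sp4 (a + a') (b + b') (c + c') (d + d').
Proof. by apply/ffunP => -[[] []]; rewrite !ffunE. Qed.

Lemma sp4N a b c d : - sp4 a b c d = sp4 (- a) (- b) (- c) (- d).
Proof. by apply/ffunP => -[[] []]; rewrite !ffunE. Qed.

Lemma sp4Z k a b c d :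
  k *: sp4 a b c d = sp4 (k%:MP * a) (k%:MP * b) (k%:MP * c) (k%:MP * d).
Proof. by apply/ffunP => -[[] []]; rewrite sp_scaleE !ffunE. Qed.

Lemma sp4M a b c d a' b' c' d' : sp4 a b c d * sp4 a' b' c' d' =
  sp4 (a * a') (a * b' + b * a') (a * c' + c * a') (a * d' + d * a' + b * c' - c * b').
Proof. by apply/ffunP => -[[] []]; rewrite spME sp_mulE !ffunE. Qed.

Lemma sp4_0 : 0 = sp4 0 0 0 0.
Proof. by apply/ffunP => -[[] []]; rewrite !ffunE. Qed.

Lemma sp4_1 : 1 = sp4 1 0 0 0.
Proof. by apply/ffunP => -[[] []]; rewrite !ffunE. Qed.

Lemma zvar1E : zvar K i1 = sp4 x 0 0 0.
Proof. by apply/ffunP => -[[] []]; rewrite !ffunE. Qed.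
Lemma zvar2E : zvar K i2 = sp4 y 0 0 0.
Proof. by apply/ffunP => -[[] []]; rewrite !ffunE. Qed.
Lemma zvar3E : zvar K i3 = sp4 0 1 0 0.
Proof. by apply/ffunP => -[[] []]; rewrite !ffunE. Qed.
Lemma zvar4E : zvar K i4 = sp4 0 0 1 0.
Proof. by apply/ffunP => -[[] []]; rewrite !ffunE. Qed.

Lemma pd1E a b c d : pd i1 (sp4 a b c d) = sp4 (d1 a) (d1 b) (d1 c) (d1 d).
Proof. by apply/ffunP => -[[] []]; rewrite pdE !ffunE. Qed.
Lemma pd2E a b c d : pd i2 (sp4 a b c d) = sp4 (d2 a) (d2 b) (d2 c) (d2 d).
Proof. by apply/ffunP => -[[] []]; rewrite pdE !ffunE. Qed.
Lemma pd3E a b c d : pd i3 (sp4 a b c d) = sp4 b 0 d 0.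
Proof. by apply/ffunP => -[[] []]; rewrite pdE !ffunE. Qed.
Lemma pd4E a b c d : pd i4 (sp4 a b c d) = sp4 c (- d) 0 0.
Proof.
by apply/ffunP => -[[] []]; rewrite pdE !ffunE //= ?expr1 ?expr0 ?mulN1r ?mul1r.
Qed.

Lemma zvar_mull a b c d :
  (((zvar K i1 * sp4 a b c d)%R = sp4 (x * a) (x * b) (x * c) (x * d)) *
   ((zvar K i2 * sp4 a b c d)%R = sp4 (y * a) (y * b) (y * c) (y * d)) *
   ((zvar K i3 * sp4 a b c d)%R = sp4 0 a 0 c) *
   ((zvar K i4 * sp4 a b c d)%R = sp4 0 0 a (- b)))%type.
Proof.
by do ![split]; rewrite ?zvar1E ?zvar2E ?zvar3E ?zvar4E sp4M; apply: sp4_eq; ring.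
Qed.

Lemma zvar_mulr a b c d :
  (((sp4 a b c d * zvar K i1)%R = sp4 (x * a) (x * b) (x * c) (x * d)) *
   ((sp4 a b c d * zvar K i2)%R = sp4 (y * a) (y * b) (y * c) (y * d)) *
   ((sp4 a b c d * zvar K i3)%R = sp4 0 a 0 (- c)) *
   ((sp4 a b c d * zvar K i4)%R = sp4 0 0 a b))%type.
Proof.
by do ![split]; rewrite ?zvar1E ?zvar2E ?zvar3E ?zvar4E sp4M; apply: sp4_eq; ring.
Qed.

Definition sp4E := (zvar_mull, zvar_mulr, pd1E, pd2E, pd3E, pd4E, sp4D, sp4N, sp4Z).

Lemma mderiv_XU (i j : 'I_2) : ('X_j : A)^`M(i) = (j == i)%:R.
Proof.
rewrite mderivX mnm1E; case: eqP => [->|_]; last by rewrite scale0r.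
by rewrite scale1r (_ : (_ - _)%MM = 0%MM) ?mpolyX0 //; apply/mnmP => a;
  rewrite mnmBE subnn mnmE.
Qed.

Lemma mpolyC_nat n : (n%:R%:MP : A) = n%:R.
Proof. exact: (rmorph_nat (@mpolyC 2 K)). Qed.

Lemma mpolyCE : ((forall k, ((- k)%:MP = - k%:MP :> A)%R) *
  (forall k l, ((k * l)%:MP = k%:MP * l%:MP :> A)%R) *
  ((1%:MP = 1 :> A)%R))%type.
Proof.
split; first split;
  [exact: mpolyCN | exact: mpolyCM | exact: mpolyC1].
Qed.

(** The rules are stated for abstract functions [D1], [D2], [C] and polynomials [X],
[Y], so that a goal can be normalized after the concrete derivations, constants
and variables have been generalized. *)
Definition Leibniz_rules (D1 D2 : A -> A) (C : K -> A) (X Y : A) :=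
  ((forall u v : A, (D1 (u + v) = D1 u + D1 v)%R) *
   (forall u : A, (D1 (- u) = - D1 u)%R) *
   (forall u : A, (D1 (X * u) = u + X * D1 u)%R) *
   (forall u : A, (D1 (Y * u) = Y * D1 u)%R) *
   (forall k (u : A), (D1 (C k * u) = C k * D1 u)%R) *
   ((D1 0 = 0)%R) * ((D1 1 = 0)%R) *
   (forall u v : A, (D2 (u + v) = D2 u + D2 v)%R) *
   (forall u : A, (D2 (- u) = - D2 u)%R) *
   (forall u : A, (D2 (X * u) = X * D2 u)%R) *
   (forall u : A, (D2 (Y * u) = u + Y * D2 u)%R) *
   (forall k (u : A), (D2 (C k * u) = C k * D2 u)%R) *
   ((D2 0 = 0)%R) * ((D2 1 = 0)%R) *
   (forall u : A, (D2 (D1 u) = D1 (D2 u))%R))%type.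

Lemma mderivE : Leibniz_rules d1 d2 (@mpolyC 2 K) x y.
Proof.
rewrite /Leibniz_rules; have d0 i : (1 : A)^`M(i) = 0 by rewrite -mpolyC1 mderivC.
repeat match goal with |- prod _ _ => split end; move=> *;
  rewrite ?mderivM ?mderiv_XU ?mderiv_mulC //.
all: rewrite ?(mderivD, mderivN, mderivC, mderiv0, d0) ?mul1r ?mul0r ?add0r //.
exact: mderiv_comm.
Qed.

End Components.

(** Proves an identity between polynomials and their derivatives.  Once the
derivations, the constants and the variables are generalized, unification cannot
unfold the representation of polynomials, and [ring] sees the iterated derivatives
as atoms. *)
Ltac poly_ring := rewrite ?mpolyCE;
  let r := fresh in let r2 := fresh in
  match goal with |- @eq (mpoly 2 ?K) _ _ => have := mderivE K; have := @mpolyC_nat K 2 end;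
  move: (mderiv ord0) (mderiv ord_max) (@mpolyC _ _) 'X_ord0 'X_ord_max => ? ? ? ? ? r2 r;
  rewrite ?r ?r2; ring.
Ltac sp_ring := rewrite ?sp4E; apply: sp4_eq; poly_ring.

(** * The Bessel operators supercommute *)
Section BesselComponents.
Variables (K : fieldType) (al mu : K).
Local Notation P := (superpoly K).
Local Notation A := {mpoly K[2]}.
Local Notation x := ('X_ord0 : A).
Local Notation y := ('X_ord_max : A).
Local Notation d1 := (mderiv (ord0 : 'I_2)).
Local Notation d2 := (mderiv (ord_max : 'I_2)).
Variable lam : K.
(* The quotient mu of lam by al is a parameter of its own: the identities below
   are then polynomial in al and mu, without inverses. *)
Hypothesis lamE : lam = al * mu.
Hypothesis muE : lam / al = mu.
Local Notation B := (bessel al lam).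
Implicit Types f g : P.

Lemma bessel1E a b c d : B i1 (sp4 a b c d) =
  sp4 (- (al%:MP * (mu%:MP * d1 a)) + x * d1 (d1 a) + 2%:MP * (al%:MP * (y * d)))
      (- (al%:MP * (mu%:MP * d1 b)) + x * d1 (d1 b) + d1 b)
      (- (al%:MP * (mu%:MP * d1 c)) + x * d1 (d1 c) + d1 c)
      (- (al%:MP * (mu%:MP * d1 d)) + x * d1 (d1 d) + 2%:MP * d1 d).
Proof. rewrite /bessel /= lamE; rewrite ?sp4E ?mpolyCM ?mpolyCD; sp_ring. Qed.

Lemma bessel2E a b c d : B i2 (sp4 a b c d) =
  sp4 (- (mu%:MP * d2 a) + y * d2 (d2 a) + 2%:MP * (x * d))
      (- (mu%:MP * d2 b) + y * d2 (d2 b) + d2 b)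
      (- (mu%:MP * d2 c) + y * d2 (d2 c) + d2 c)
      (- (mu%:MP * d2 d) + y * d2 (d2 d) + 2%:MP * d2 d).
Proof. rewrite /bessel /= muE; rewrite ?sp4E ?mpolyCM ?mpolyCD; sp_ring. Qed.

Lemma bessel3E a b c d : B i3 (sp4 a b c d) =
  sp4 (- (2%:MP * (al%:MP * (mu%:MP * c))) + 2%:MP * (x * d1 c) + 2%:MP * (al%:MP * (y * d2 c)))
      (2%:MP * (al%:MP * (mu%:MP * d)) - 2%:MP * (x * d1 d) - 2%:MP * (al%:MP * (y * d2 d))
        - 2%:MP * (d + al%:MP * d) + d1 (d2 a))
      0 (d1 (d2 c)).
Proof. rewrite /bessel /= lamE; rewrite ?sp4E ?mpolyCM ?mpolyCD; sp_ring. Qed.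

Lemma bessel4E a b c d : B i4 (sp4 a b c d) =
  sp4 (2%:MP * (al%:MP * (mu%:MP * b)) - 2%:MP * (x * d1 b) - 2%:MP * (al%:MP * (y * d2 b)))
      0
      (2%:MP * (al%:MP * (mu%:MP * d)) - 2%:MP * (x * d1 d) - 2%:MP * (al%:MP * (y * d2 d))
        - 2%:MP * (d + al%:MP * d) + d1 (d2 a))
      (- d1 (d2 b)).
Proof. rewrite /bessel /= lamE; rewrite ?sp4E ?mpolyCM ?mpolyCD; sp_ring. Qed.

Definition besselE := (bessel1E, bessel2E, bessel3E, bessel4E).

Local Ltac bring := rewrite ?besselE; sp_ring.

Lemma bessel12 f : B i1 (B i2 f) = B i2 (B i1 f).
Proof. elim/sp4_ind: f => a b c d; bring. Qed.
Lemma bessel13 f : B i3 (B i1 f) = B i1 (B i3 f).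
Proof. elim/sp4_ind: f => a b c d; bring. Qed.
Lemma bessel14 f : B i4 (B i1 f) = B i1 (B i4 f).
Proof. elim/sp4_ind: f => a b c d; bring. Qed.
Lemma bessel23 f : B i3 (B i2 f) = B i2 (B i3 f).
Proof. elim/sp4_ind: f => a b c d; bring. Qed.
Lemma bessel24 f : B i4 (B i2 f) = B i2 (B i4 f).
Proof. elim/sp4_ind: f => a b c d; bring. Qed.
Lemma bessel34 f : B i4 (B i3 f) = - B i3 (B i4 f).
Proof. elim/sp4_ind: f => a b c d; bring. Qed.
Lemma bessel33 f : B i3 (B i3 f) = 0.
Proof. elim/sp4_ind: f => a b c d; rewrite [0]sp4_0; bring. Qed.
Lemma bessel44 f : B i4 (B i4 f) = 0.
Proof. elim/sp4_ind: f => a b c d; rewrite [0]sp4_0; bring. Qed.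

End BesselComponents.

(** * Induction on superpolynomials *)
Section LinearFunctions.
Variables (K : comNzRingType) (U V : lmodType K) (f : U -> V).
Hypothesis flin : linear f.

Lemma lin0 : f 0 = 0.
Proof. by have := flin (-1) 0 0; rewrite scaler0 addr0 scaleN1r addNr. Qed.

Lemma linZ k u : f (k *: u) = k *: f u.
Proof. by rewrite -[k *: u]addr0 flin lin0 addr0. Qed.

Lemma linD u v : f (u + v) = f u + f v.
Proof. by rewrite -{1}[u]scale1r flin scale1r. Qed.

Lemma linN u : f (- u) = - f u.
Proof. by rewrite -scaleN1r linZ scaleN1r. Qed.

End LinearFunctions.

Section Induction.
Variable K : comNzRingType.
Local Notation P := (superpoly K).

Definition linear_prop (Q : P -> Prop) := forall (k : K) f g, Q f -> Q g -> Q (k *: f + g).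

Lemma sp_injE s (p : {mpoly K[2]}) : sp_inj s p =
  match s with (false, false) => sp4 p 0 0 0 | (true, false) => sp4 0 p 0 0
  | (false, true) => sp4 0 0 p 0 | (true, true) => sp4 0 0 0 p end.
Proof. by apply/ffunP => t; rewrite ffunE; case: s t => [[] []] [[] []]; rewrite ffunE. Qed.

Lemma sp_inj_linear s : linear (@sp_inj K s).
Proof. by move=> k p q; apply/ffunP => t; rewrite !ffunE; case: eqP; rewrite ?scaler0 ?addr0. Qed.

Lemma sp_monomial_ind (Q : P -> Prop) : linear_prop Q ->
  (forall s m, Q (sp_inj s 'X_[m])) -> forall f, Q f.
Proof.
move=> hQ hm; have q0 : Q 0.
  by rewrite -[0](addNr (sp_inj (false, false) 'X_[0])) -scaleN1r; apply: hQ; apply: hm.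
have qD f g : Q f -> Q g -> Q (f + g) by move=> hf hg; rewrite -[f]scale1r; apply: hQ.
have q s p : Q (sp_inj s p).
  elim/mpolyind: p => [|c m p _ _ hp]; last by rewrite sp_inj_linear; apply: hQ.
  by rewrite (_ : sp_inj s 0 = 0) //; apply/ffunP => t; rewrite !ffunE if_same.
move=> f; have -> : f = sp_inj (false, false) (f (false, false)) +
   sp_inj (true, false) (f (true, false)) + sp_inj (false, true) (f (false, true)) +
   sp_inj (true, true) (f (true, true)).
  by rewrite [LHS]sp4K !sp_injE !sp4D !(addr0, add0r).
by do 3 (apply: (qD); last exact: (q)); exact: q.
Qed.

Lemma sp_monomialE s m : sp_inj s 'X_[m] =
  zvar K i1 ^+ m ord0 * zvar K i2 ^+ m ord_max * zvar K i3 ^+ s.1 * zvar K i4 ^+ s.2.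
Proof.
have pw (p : {mpoly K[2]}) n : sp4 p 0 0 0 ^+ n = sp4 (p ^+ n) 0 0 0.
  elim: n => [|n IH]; first by rewrite !expr0 sp4_1.
  by rewrite !exprS IH sp4M; apply: sp4_eq; rewrite ?(mulr0, mul0r, addr0, subr0).
rewrite mpolyXE_id !big_ord_recl big_ord0 mulr1 zvar1E zvar2E !pw zvar3E zvar4E sp_injE.
have -> : lift ord0 ord0 = ord_max :> 'I_2 by apply: val_inj.
by case: s => [[] []] /=; rewrite ?expr1 ?expr0 ?mulr1 !sp4M; apply: sp4_eq;
  rewrite ?(mulr0, mul0r, mulr1, addr0, add0r, subr0, oppr0).
Qed.

(** Every monomial is a product of the variables in the order z_1, z_2, z_3, z_4, so
superpolynomials are built from 1 by multiplication by one variable at a time, on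
either side. *)
Lemma sp_right_ind (Q : P -> Prop) : linear_prop Q -> Q 1 ->
  (forall b p, Q p -> Q (p * zvar K b)) -> forall f, Q f.
Proof.
move=> hQ q1 qz; have qX b n p : Q p -> Q (p * zvar K b ^+ n).
  by elim: n p => [|n IH] p hp; rewrite ?expr0 ?mulr1 // exprS mulrA; apply/IH/qz.
apply: sp_monomial_ind => // s m; rewrite sp_monomialE.
by do 3! apply: (qX); rewrite -[_ ^+ _]mul1r; apply: qX.
Qed.

Lemma sp_left_ind (Q : P -> Prop) : linear_prop Q -> Q 1 ->
  (forall b p, Q p -> Q (zvar K b * p)) -> forall f, Q f.
Proof.
move=> hQ q1 qz; have qX b n p : Q p -> Q (zvar K b ^+ n * p).
  by elim: n p => [|n IH] p hp; rewrite ?expr0 ?mul1r // exprSr -mulrA; apply/IH/qz.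
apply: sp_monomial_ind => // s m; rewrite sp_monomialE -!mulrA.
by do 3! apply: (qX); rewrite -[_ ^+ _]mulr1; apply: qX.
Qed.

End Induction.

(** * The bilinear form and its adjoints *)
Section Form.
Variables (K : fieldType) (al mu lam : K).
Hypothesis lamE : lam = al * mu.
Hypothesis muE : lam / al = mu.
Local Notation P := (superpoly K).
Local Notation A := {mpoly K[2]}.
Local Notation B := (bessel al lam).
Local Notation z b := (zvar K b).
Implicit Types f g p q : P.

Local Ltac bring := rewrite ?sp4E ?(besselE lamE muE); sp_ring.

Lemma bessel_linear b : linear (B b).
Proof.
move=> k; elim/sp4_ind => a b' c d; elim/sp4_ind => a' b'' c' d'.
by move: b; apply: ord4P; bring.
Qed.

Definition bessel_monomial (s : bool * bool) (m : 'X_{1..2}) g : P :=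
  iter (m ord0) (B i1) (iter (m ord_max) (B i2) (iter s.1 (B i3) (iter s.2 (B i4) g))).

Lemma bessel_monomial_linear s m : linear (bessel_monomial s m).
Proof.
have hi (h : P -> P) n : linear h -> linear (iter n h).
  by move=> hh k f g; elim: n => //= n ->; rewrite hh.
by move=> k f g; rewrite /bessel_monomial !hi //; apply: bessel_linear.
Qed.

Lemma bessel_subst_linearl g : linear (fun p => bessel_subst al lam p g).
Proof.
have coefs (V : lmodType K) (F : 'X_{1..2} -> V) :
    linear (fun p : A => \sum_(m <- msupp p) p@_m *: F m).
  move=> k p q; pose n := (msize (k *: p + q) + (msize p + msize q))%N.
  have E (r : A) : (msize r <= n)%N -> \sum_(m <- msupp r) r@_m *: F m
      = \sum_(m : 'X_{1..2 < n}) r@_m *: F m.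
    move=> hr; pose I : subFinType _ := 'X_{1..2 < n}.
    rewrite (big_mksub I) ?msupp_uniq //=; last first.
      by move=> m /msize_mdeg_lt /leq_trans; apply.
    by rewrite big_rmcond //= => m /memN_msupp_eq0 ->; rewrite scale0r.
  have np : (msize p <= n)%N by rewrite /n addnCA leq_addr.
  have nq : (msize q <= n)%N by rewrite /n addnA leq_addl.
  rewrite !E ?leq_addr //.
  rewrite scaler_sumr -big_split; apply: eq_bigr => m _ /=.
  by rewrite mcoeffD mcoeffZ scalerDl scalerA.
move=> k p q; rewrite /bessel_subst scaler_sumr -big_split; apply: eq_bigr => s _ /=.
by rewrite -coefs !ffunE.
Qed.

Lemma bessel_subst_linearr p : linear (bessel_subst al lam p).
Proof.
move=> k f g; rewrite /bessel_subst scaler_sumr -big_split; apply: eq_bigr => s _ /=.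
rewrite scaler_sumr -big_split; apply: eq_bigr => m _ /=.
by rewrite -!/(bessel_monomial s m _) bessel_monomial_linear scalerDr !scalerA mulrC.
Qed.

Lemma bessel_subst_monomial s m g :
  bessel_subst al lam (sp_inj s 'X_[m]) g = bessel_monomial s m g.
Proof.
rewrite /bessel_subst (bigD1 s) //= [X in _ + X]big1 ?addr0; last first.
  by move=> t ts; rewrite ffunE (negPf ts) msupp0 big_nil.
by rewrite ffunE eqxx msuppX big_seq1 mcoeffX eqxx scale1r.
Qed.

(** This is where supercommutation is used: substitution evaluates the operators in
the order of the variables in a monomial, and multiplying by z_b on the right
reorders the factors of the monomial with the same signs as B_b past the others.
The cases where z_3 or z_4 is repeated use that B_3 and B_4 square to 0. *)
Lemma bessel_subst_mulr p b g :
  bessel_subst al lam (p * z b) g = bessel_subst al lam p (B b g).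
Proof.
elim/sp_monomial_ind: p => [k p q hp hq|s m].
  by rewrite mulrDl -scalerAl !bessel_subst_linearl hp hq.
have ic (h k : P -> P) n f : (forall f, h (k f) = k (h f)) -> iter n h (k f) = k (iter n h f).
  by move=> hk; elim: n => //= n ->.
have mE t f : bessel_subst al lam (sp_inj t 'X_[m]) f =
    bessel_monomial (false, false) m (iter t.1 (B i3) (iter t.2 (B i4) f)).
  by rewrite bessel_subst_monomial.
have m0 : bessel_monomial (false, false) m 0 = 0.
  exact: lin0 (bessel_monomial_linear _ _).
have mN f : bessel_monomial (false, false) m (- f) = - bessel_monomial (false, false) m f.
  exact: linN (bessel_monomial_linear _ _) _.
have s0 h : bessel_subst al lam 0 h = 0 by exact: lin0 (bessel_subst_linearl h).
have sN q h : bessel_subst al lam (- q) h = - bessel_subst al lam q h.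
  exact: linN (bessel_subst_linearl h) q.
have X0 : sp4 0 0 0 0 = 0 :> P by rewrite -sp4_0.

move: b; apply: ord4P.
- have -> : sp_inj s 'X_[m] * z i1 = sp_inj s 'X_[m + U_(ord0)].
    by rewrite mpolyXD zvar1E; case: s => [[] []]; rewrite !sp_injE sp4M; apply: sp4_eq;
      rewrite ?(mulr0, mul0r, addr0, add0r, subr0, oppr0).
  rewrite !bessel_subst_monomial /bessel_monomial !mnmDE !mnm1E /= addn0 addn1 iterSr.
  apply: (congr1 (iter _ (B i1))).
  have h21 n f : iter n (B i2) (B i1 f) = B i1 (iter n (B i2) f).
    by apply: ic => f'; rewrite (bessel12 lamE muE).
  rewrite -h21; apply: (congr1 (iter _ (B i2))); case: s => [[] []] /=.
  + by rewrite (bessel14 lamE) (bessel13 lamE).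
  + by rewrite (bessel13 lamE).
  + by rewrite (bessel14 lamE).
  + by [].
- have -> : sp_inj s 'X_[m] * z i2 = sp_inj s 'X_[m + U_(ord_max)].
    by rewrite mpolyXD zvar2E; case: s => [[] []]; rewrite !sp_injE sp4M; apply: sp4_eq;
      rewrite ?(mulr0, mul0r, addr0, add0r, subr0, oppr0).
  rewrite !bessel_subst_monomial /bessel_monomial !mnmDE !mnm1E /= addn0 addn1 iterSr.
  apply: (congr1 (fun f => iter _ (B i1) (iter _ (B i2) f))).
  case: s => [[] []] /=.
  + by rewrite (bessel24 lamE muE) (bessel23 lamE muE).
  + by rewrite (bessel23 lamE muE).
  + by rewrite (bessel24 lamE muE).
  + by [].
- have -> : sp_inj s 'X_[m] * z i3 = match s with (false, false) => sp_inj (true, false) 'X_[m]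
     | (false, true) => - sp_inj (true, true) 'X_[m] | _ => 0 end.
    by rewrite zvar3E; case: s => [[] []]; rewrite !sp_injE sp4M -?X0 ?sp4N; apply: sp4_eq;
      rewrite ?(mulr0, mul0r, addr0, add0r, subr0, oppr0, mulr1, sub0r).
  case: s => [[] []]; rewrite ?s0 ?sN !mE /=.
  + by rewrite (bessel34 lamE) (linN (bessel_linear _)) (bessel33 lamE) mN m0 oppr0.
  + by rewrite (bessel33 lamE) m0.
  + by rewrite (bessel34 lamE) mN.
  + by [].
- have -> : sp_inj s 'X_[m] * z i4 = if s.2 then 0 else sp_inj (s.1, true) 'X_[m].
    by rewrite zvar4E; case: s => [[] []]; rewrite !sp_injE sp4M -?X0 ?sp4N; apply: sp4_eq;
      rewrite ?(mulr0, mul0r, addr0, add0r, subr0, oppr0, mulr1, sub0r).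
  case: s => [[] []]; rewrite /= ?s0 !mE //=.
  + by rewrite (bessel44 lamE) (lin0 (bessel_linear _)) m0.
  + by rewrite (bessel44 lamE) m0.
Qed.

Definition form p g : K := eval0 (bessel_subst al lam p g).

Lemma eval0_linear : linear (@eval0 K : P -> K^o).
Proof. by move=> k f g; rewrite /eval0 sp_addE sp_scaleE mcoeffD mcoeffCM. Qed.

Lemma form_linearl g : linear (fun p => form p g : K^o).
Proof. by move=> k p q; rewrite /form bessel_subst_linearl eval0_linear. Qed.

Lemma form_linearr p : linear (fun g => form p g : K^o).
Proof. by move=> k f g; rewrite /form bessel_subst_linearr eval0_linear. Qed.

Lemma form_mulr p b g : form (p * z b) g = form p (B b g).
Proof. by rewrite /form bessel_subst_mulr. Qed.

Lemma form_1 g : form 1 g = eval0 g.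
Proof.
have -> : 1 = sp_inj (false, false) 'X_[0] :> P by rewrite sp_injE mpolyX0 -sp4_1.
by rewrite /form bessel_subst_monomial /bessel_monomial !mnm0E.
Qed.

Definition adjoint (S S' : P -> P) := forall p g, form p (S g) = form (S' p) g.

Lemma adjoint_eq S S' T T' : adjoint S S' -> S =1 T -> S' =1 T' -> adjoint T T'.
Proof. by move=> h e e' p g; rewrite -e -e'. Qed.

Lemma adjointD S S' T T' : adjoint S S' -> adjoint T T' ->
  adjoint (fun f => S f + T f) (fun f => S' f + T' f).
Proof.
move=> hS hT p g.
by rewrite (linD (form_linearr p)) (linD (form_linearl g)) /= hS hT.
Qed.

Lemma adjointZ k S S' : adjoint S S' ->
  adjoint (fun f => k *: S f) (fun f => k *: S' f).
Proof.
move=> hS p g.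
by rewrite (linZ (form_linearr p)) (linZ (form_linearl g)) /= hS.
Qed.

Lemma adjoint_bessel b : adjoint (B b) (fun p => p * z b).
Proof. by move=> p g; rewrite form_mulr. Qed.

(** The induction behind every adjoint other than those of the Bessel operators.
Knowing p |-> <p, S g> for p', one gets it for p' z_b by moving S past B_b; the
commutator T is an operator whose adjoint is already known. *)
Lemma adjoint_comm S S' : linear S' -> (forall g, eval0 (S g) = form (S' 1) g) ->
  (forall b, exists (s : K) T T', [/\ adjoint T T',
     forall g, B b (S g) = s *: S (B b g) + T g &
     forall p, S' (p * z b) = s *: (S' p * z b) + T' p]) ->
  adjoint S S'.
Proof.
move=> linS' h1 hb; elim/sp_right_ind => [k p q hp hq||b p hp] g.
- by rewrite linS' !form_linearl hp hq.
- by rewrite form_1 h1.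
have [s [T [T' [hT hS hS']]]] := hb b.
by rewrite form_mulr hS form_linearr hp hT hS' form_linearl form_mulr.
Qed.

End Form.

(** * Adjoints of the structure algebra *)
Section StructureAlgebra.
Variables (K : fieldType) (al mu lam : K).
Hypothesis lamE : lam = al * mu.
Hypothesis muE : lam / al = mu.
Local Notation P := (superpoly K).
Local Notation A := {mpoly K[2]}.
Local Notation x := ('X_ord0 : A).
Local Notation y := ('X_ord_max : A).
Local Notation d1 := (mderiv (ord0 : 'I_2)).
Local Notation d2 := (mderiv (ord_max : 'I_2)).
Local Notation B := (bessel al lam).
Local Notation z b := (zvar K b).
Local Notation adjoint := (adjoint al lam).
Implicit Types f g p q : P.

(** The even part of str(D_alpha) acting by vector fields: n1 and n2 are the
coefficients of twice L_(e_1) and L_(e_2), and the triple h, e, t is the copy of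
sl(2) formed by the even derivations, which acts on the odd variables. *)
Definition str_even (n1 n2 h e t : K) g : P :=
  (2 * n1) *: (z i1 * pd i1 g) + (2 * n2) *: (z i2 * pd i2 g)
  + (n1 + n2 + h) *: (z i3 * pd i3 g) + (n1 + n2 - h) *: (z i4 * pd i4 g)
  + e *: (z i3 * pd i4 g) + t *: (z i4 * pd i3 g).

(** The odd part of str(D_alpha): L_xi is (u3, v3) = (1/2, 1/2) and L_eta is
(u4, v4) = (1/2, 1/2), while the odd derivations are the combinations with
opposite u and v.  The adjoint thus exchanges u and v. *)
Definition str_odd u3 v3 u4 v4 g : P :=
  u3 *: (z i3 * pd i1 g) + u4 *: (z i4 * pd i1 g)
  + v3 *: (z i3 * pd i2 g) + v4 *: (z i4 * pd i2 g)
  + (2 * al * u3) *: (z i2 * pd i4 g) + (2 * v3) *: (z i1 * pd i4 g)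
  - (2 * al * u4) *: (z i2 * pd i3 g) - (2 * v4) *: (z i1 * pd i3 g).

Lemma str_evenE n1 n2 h e t a b c d : str_even n1 n2 h e t (sp4 a b c d) =
  sp4 (2%:MP * (n1%:MP * (x * d1 a)) + 2%:MP * (n2%:MP * (y * d2 a)))
      (2%:MP * (n1%:MP * (x * d1 b)) + 2%:MP * (n2%:MP * (y * d2 b))
        + (n1%:MP * b + n2%:MP * b + h%:MP * b) + e%:MP * c)
      (2%:MP * (n1%:MP * (x * d1 c)) + 2%:MP * (n2%:MP * (y * d2 c))
        + (n1%:MP * c + n2%:MP * c - h%:MP * c) + t%:MP * b)
      (2%:MP * (n1%:MP * (x * d1 d)) + 2%:MP * (n2%:MP * (y * d2 d))
        + 2%:MP * (n1%:MP * d + n2%:MP * d)).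
Proof. by rewrite /str_even ?sp4E ?mpolyCM ?mpolyCB ?mpolyCD; sp_ring. Qed.

Lemma str_oddE u3 v3 u4 v4 a b c d : str_odd u3 v3 u4 v4 (sp4 a b c d) =
  sp4 (2%:MP * (al%:MP * (y * (u3%:MP * c))) - 2%:MP * (al%:MP * (y * (u4%:MP * b)))
        + 2%:MP * (x * (v3%:MP * c)) - 2%:MP * (x * (v4%:MP * b)))
      (u3%:MP * d1 a + v3%:MP * d2 a - 2%:MP * (al%:MP * (y * (u3%:MP * d)))
        - 2%:MP * (x * (v3%:MP * d)))
      (u4%:MP * d1 a + v4%:MP * d2 a - 2%:MP * (al%:MP * (y * (u4%:MP * d)))
        - 2%:MP * (x * (v4%:MP * d)))
      (u3%:MP * d1 c + v3%:MP * d2 c - u4%:MP * d1 b - v4%:MP * d2 b).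
Proof. by rewrite /str_odd ?sp4E ?mpolyCM ?mpolyCD; sp_ring. Qed.

(** The parity involution, which carries the signs (-1)^|p|: identities of
homogeneous elements become identities of operators. *)
Definition grade f : P := [ffun s => (-1) ^+ (s.1 (+) s.2) *: f s].

Lemma gradeE a b c d : grade (sp4 a b c d) = sp4 a (- b) (- c) d.
Proof.
by apply/ffunP => -[[] []]; rewrite !ffunE /= ?expr0 ?expr1 ?scale1r ?scaleN1r.
Qed.

Local Ltac bring := cbv beta; do 2 rewrite ?sp4E ?(besselE lamE muE) ?str_evenE
  ?str_oddE ?gradeE; sp_ring.

Definition gradeb (k : bool) f := if k then grade f else f.

Lemma grade_linear : linear grade.
Proof. by move=> k f g; apply/ffunP => s; rewrite !ffunE scalerDr !scalerA mulrC. Qed.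

Lemma gradeK : involutive grade.
Proof. by elim/sp4_ind => a b c d; rewrite !gradeE !opprK. Qed.

Lemma str_even_linear n1 n2 h e t : linear (str_even n1 n2 h e t).
Proof. by move=> k; elim/sp4_ind => a b c d; elim/sp4_ind => a' b' c' d'; bring. Qed.

Lemma str_odd_linear u3 v3 u4 v4 : linear (str_odd u3 v3 u4 v4).
Proof. by move=> k; elim/sp4_ind => a b c d; elim/sp4_ind => a' b' c' d'; bring. Qed.

Lemma str_even1 n1 n2 h e t : str_even n1 n2 h e t 1 = 0.
Proof. by rewrite [1]sp4_1 [RHS]sp4_0; bring. Qed.

Lemma str_odd1 u3 v3 u4 v4 : str_odd u3 v3 u4 v4 1 = 0.
Proof. by rewrite [1]sp4_1 [RHS]sp4_0; bring. Qed.

Lemma eval0_zvar b g : eval0 (z b * g) = 0.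
Proof.
elim/sp4_ind: g => a b' c d; move: b.
by apply: ord4P; rewrite sp4E /eval0 ffunE ?mcoeff0 // rmorphM /= mcoeffX
  mnm1_eq0 mul0r.
Qed.

Lemma eval0D_eq0 f g : eval0 f = 0 -> eval0 g = 0 -> eval0 (f + g) = 0.
Proof. by rewrite /eval0 sp_addE mcoeffD => -> ->; rewrite addr0. Qed.

Lemma eval0N_eq0 f : eval0 f = 0 -> eval0 (- f) = 0.
Proof. by move=> f0; rewrite (linN (@eval0_linear K)) f0 oppr0. Qed.

Lemma eval0Z_zvar k b g : eval0 (k *: (z b * g)) = 0.
Proof. by rewrite /eval0 sp_scaleE mcoeffCM -/(eval0 _) eval0_zvar mulr0. Qed.

Lemma eval0_str_even n1 n2 h e t g : eval0 (str_even n1 n2 h e t g) = 0.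
Proof. by do 5 (apply: eval0D_eq0; last exact: eval0Z_zvar); exact: eval0Z_zvar. Qed.

Lemma eval0_str_odd u3 v3 u4 v4 g : eval0 (str_odd u3 v3 u4 v4 g) = 0.
Proof.
do 2 (apply: eval0D_eq0; last by apply: eval0N_eq0; exact: eval0Z_zvar).
by do 5 (apply: eval0D_eq0; last exact: eval0Z_zvar); exact: eval0Z_zvar.
Qed.

Lemma form0l g : form al lam 0 g = 0.
Proof. exact: lin0 (form_linearl al lam g). Qed.

(** The supercommutator of such a vector field with B_b is the Bessel operator of the
image of z_b under the adjoint vector field: the z_b and the B_b span dual
representations of the structure algebra. *)
Lemma adjoint_str_even n1 n2 h e t :
  adjoint (str_even n1 n2 h e t) (str_even n1 n2 (- h) (- e) (- t)).
Proof.
apply: (adjoint_comm lamE muE (str_even_linear _ _ _ _ _)) => [g|].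
  by rewrite eval0_str_even str_even1 form0l.
have aB := adjoint_bessel lamE muE; have aZ b k := adjointZ lamE muE k (aB b).
pose D b k c l := adjointD lamE muE (aZ b k) (aZ c l).
(* For each b, the image of z_b under the adjoint vector field. *)
apply: ord4P.
- exists 1; do 2 eexists; split; first exact: (aZ i1 (2 * n1)).
    by elim/sp4_ind => a b c d; bring.
  by elim/sp4_ind => a b c d; bring.
- exists 1; do 2 eexists; split; first exact: (aZ i2 (2 * n2)).
    by elim/sp4_ind => a b c d; bring.
  by elim/sp4_ind => a b c d; bring.
- exists 1; do 2 eexists; split;
    first exact: (adjointD lamE muE (D i3 n1 i3 n2) (D i3 (- h) i4 (- t))).
    by elim/sp4_ind => a b c d; bring.
  by elim/sp4_ind => a b c d; bring.
- exists 1; do 2 eexists; split; first exact: (adjointD lamE muE (D i4 n1 i4 n2) (D i4 h i3 (- e))).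
    by elim/sp4_ind => a b c d; bring.
  by elim/sp4_ind => a b c d; bring.
Qed.

Lemma adjoint_str_odd u3 v3 u4 v4 :
  adjoint (str_odd u3 v3 u4 v4) (fun p => str_odd v3 u3 v4 u4 (grade p)).
Proof.
apply: (adjoint_comm lamE muE).
- by move=> k p q; rewrite grade_linear str_odd_linear.
- by move=> g; rewrite eval0_str_odd [1]sp4_1 gradeE !oppr0 -sp4_1 str_odd1 form0l.
have aB := adjoint_bessel lamE muE; have aZ b k := adjointZ lamE muE k (aB b).
pose D b k c l := adjointD lamE muE (aZ b k) (aZ c l).
apply: ord4P.
- exists 1; do 2 eexists; split; first exact: (D i3 v3 i4 v4).
    by elim/sp4_ind => a b c d; bring.
  by elim/sp4_ind => a b c d; bring.
- exists 1; do 2 eexists; split; first exact: (D i3 u3 i4 u4).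
    by elim/sp4_ind => a b c d; bring.
  by elim/sp4_ind => a b c d; bring.
- exists (- 1); do 2 eexists; split; first exact: (D i2 (2 * al * v4) i1 (2 * u4)).
    by elim/sp4_ind => a b c d; bring.
  by elim/sp4_ind => a b c d; bring.
- exists (- 1); do 2 eexists; split; first exact: (D i2 (- (2 * al * v3)) i1 (- (2 * u3))).
    by elim/sp4_ind => a b c d; bring.
  by elim/sp4_ind => a b c d; bring.
Qed.

End StructureAlgebra.

(** * Multiplication by a variable is adjoint to a Bessel operator *)
Section Multiplication.
Variables (K : fieldType) (al mu lam : K).
Hypothesis lamE : lam = al * mu.
Hypothesis muE : lam / al = mu.
Local Notation P := (superpoly K).
Local Notation B := (bessel al lam).
Local Notation z b := (zvar K b).
Local Notation adjoint := (adjoint al lam).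
Local Notation str_odd := (str_odd al).
Implicit Types f g p q : P.

Local Ltac bring := cbv beta; do 2 rewrite ?sp4E ?(besselE lamE muE) ?str_evenE ?str_oddE ?gradeE;
  rewrite ?lamE ?mpolyCN ?mpolyCM ?(mpolyCD _ 1 al) ?mpolyC1 ?mpolyC0; sp_ring.

(** The supercommutator [B_b, z_a], as an element of the structure algebra plus a
constant, just as the brackets of g between D^+ and D^- lie in str(D_alpha). *)
Definition bracket (b a : 'I_4) f : P :=
  match val b, val a with
  | 0%N, 0%N => str_even 1 0 0 0 0 f - lam *: f
  | 1%N, 1%N => str_even 0 1 0 0 0 f - mu *: f
  | 0%N, 2%N | 2%N, 1%N => str_odd 1 0 0 0 f
  | 1%N, 2%N | 2%N, 0%N => str_odd 0 1 0 0 f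
  | 0%N, 3%N | 3%N, 1%N => str_odd 0 0 1 0 f
  | 1%N, 3%N | 3%N, 0%N => str_odd 0 0 0 1 f
  | 2%N, 2%N => str_even 0 0 0 (- (2 * (1 + al))) 0 f
  | 3%N, 3%N => str_even 0 0 0 0 (2 * (1 + al)) f
  | 2%N, 3%N => str_even 1 al (1 + al) 0 0 f - (2 * lam) *: f
  | 3%N, 2%N => str_even (- 1) (- al) (1 + al) 0 0 f + (2 * lam) *: f
  | _, _ => 0
  end.

Definition sgn (k : bool) : K := if k then - 1 else 1.

Lemma bessel_zvar b a g :
  B b (z a * g) = sgn (par a && par b) *: (z a * B b g) + bracket b a g.
Proof.
elim/sp4_ind: g => p q r s; move: b a.
do 2 (apply: ord4P); rewrite /bracket /sgn /par /= ?[0]sp4_0.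
all: bring.
Qed.

Lemma zvar_comm b p : p * z b = z b * gradeb (par b) p.
Proof. by elim/sp4_ind: p => p q r s; move: b; apply: ord4P; rewrite /gradeb /par /=; bring. Qed.

Lemma grade_zvar b p : grade (z b * p) = sgn (par b) *: (z b * grade p).
Proof. by elim/sp4_ind: p => p q r s; move: b; apply: ord4P; rewrite /sgn /par /=; bring. Qed.

Lemma grade_bessel b p : grade (B b p) = sgn (par b) *: B b (grade p).
Proof. by elim/sp4_ind: p => p q r s; move: b; apply: ord4P; rewrite /sgn /par /=; bring. Qed.

Lemma gradeb_linear k : linear (@gradeb K k).
Proof. by case: k => // c f g; exact: grade_linear. Qed.

Lemma gradebD j k p : gradeb j (gradeb k p) = gradeb (j (+) k) p.
Proof. by case: j k => [] [] //=; rewrite gradeK. Qed.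

Lemma gradeb_zvar k b p : gradeb k (z b * p) = sgn (k && par b) *: (z b * gradeb k p).
Proof. by case: k => /=; rewrite ?scale1r ?grade_zvar. Qed.

Lemma gradeb_bessel k b p : gradeb k (B b p) = sgn (k && par b) *: B b (gradeb k p).
Proof. by case: k => /=; rewrite ?scale1r ?grade_bessel. Qed.

Lemma form0r p : form al lam p 0 = 0.
Proof. exact: lin0 (form_linearr lamE muE p). Qed.

Local Ltac close := elim/sp4_ind => p q r s; rewrite /bracket /sgn /par /gradeb /= ?[0]sp4_0; bring.

(** The symmetry of [B_b, z_a] under the exchange of a and b, as the adjunction sees
it. *)
Lemma adjoint_bracket b a : adjoint (bracket b a)
  (fun p => sgn (par a && par b) *: bracket a b (gradeb (par a (+) par b) p)).
Proof.
have aev n1 n2 h e t c : adjoint (fun f => str_even n1 n2 h e t f + c *: f)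
    (fun f => str_even n1 n2 (- h) (- e) (- t) f + c *: f).
  exact: (adjointD lamE muE (adjoint_str_even lamE muE _ _ _ _ _) (adjointZ lamE muE c _)).
have aod := adjoint_str_odd lamE muE.
move: b a; do 2 (apply: ord4P).
- by apply: (adjoint_eq (aev 1 0 0 0 0 (- lam))); close.
- by move=> p g; rewrite /bracket /= scaler0 form0l form0r.
- by apply: (adjoint_eq (aod 1 0 0 0)); close.
- by apply: (adjoint_eq (aod 0 0 1 0)); close.
- by move=> p g; rewrite /bracket /= scaler0 form0l form0r.
- by apply: (adjoint_eq (aev 0 1 0 0 0 (- mu))); close.
- by apply: (adjoint_eq (aod 0 1 0 0)); close.
- by apply: (adjoint_eq (aod 0 0 0 1)); close.
- by apply: (adjoint_eq (aod 0 1 0 0)); close.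
- by apply: (adjoint_eq (aod 1 0 0 0)); close.
- by apply: (adjoint_eq (aev 0 0 0 (- (2 * (1 + al))) 0 0)); close.
- by apply: (adjoint_eq (aev 1 al (1 + al) 0 0 (- (2 * lam)))); close.
- by apply: (adjoint_eq (aod 0 0 0 1)); close.
- by apply: (adjoint_eq (aod 0 0 1 0)); close.
- by apply: (adjoint_eq (aev (- 1) (- al) (1 + al) 0 0 (2 * lam))); close.
- by apply: (adjoint_eq (aev 0 0 0 0 (2 * (1 + al)) 0)); close.
Qed.

(** On p z_b the operator B_a gives rise to [B_a, z_b], while [B_b, z_a] comes from
z_a g: [adjoint_bracket] says that these two terms match. *)
Lemma adjoint_zvar a : adjoint (fun g => z a * g) (fun p => B a (gradeb (par a) p)).
Proof.
apply: (adjoint_comm lamE muE).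
- by move=> k p q; rewrite gradeb_linear (bessel_linear lamE muE).
- move=> g; rewrite eval0_zvar.
  have -> : gradeb (par a) (1 : P) = 1.
    by case: (par a) => //=; rewrite [1]sp4_1 gradeE !oppr0.
  have -> : B a 1 = 0; last by rewrite form0l.
  rewrite [1]sp4_1 [RHS]sp4_0; move: a; apply: ord4P; bring.
move=> b; exists (sgn (par a && par b)); do 2 eexists; split; first exact: (adjoint_bracket b a).
  by move=> g; rewrite bessel_zvar.
move=> p; rewrite !zvar_comm gradeb_zvar (linZ (bessel_linear lamE muE a)) bessel_zvar.
rewrite gradeb_bessel !gradebD [par b (+) par a]addbC -scalerAr.
exact: scalerDr.
Qed.

End Multiplication.

(** * The ideal lies in the radicals of the form *)
Section Radical.
Variables (K : fieldType) (al mu lam : K).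
Hypothesis lamE : lam = al * mu.
Hypothesis muE : lam / al = mu.
Local Notation P := (superpoly K).
Local Notation A := {mpoly K[2]}.
Local Notation x := ('X_ord0 : A).
Local Notation y := ('X_ord_max : A).
Local Notation d1 := (mderiv (ord0 : 'I_2)).
Local Notation d2 := (mderiv (ord_max : 'I_2)).
Local Notation B := (bessel al lam).
Local Notation z b := (zvar K b).
Local Notation form := (form al lam).
Implicit Types f g p q : P.

Section StableSubspace.
Variable Q : P -> Prop.
Hypothesis QB : forall b f, Q f -> Q (B b f).
Hypothesis Q0 : forall f, Q f -> eval0 f = 0.

(** Moving the variables of p to the right one by one turns f into an element of Q,
whose value at 0 is 0. *)
Lemma form_radicalr p f : Q f -> form p f = 0.
Proof.
elim/sp_right_ind: p f => [k p q hp hq||b p hp] f Qf.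
- by rewrite form_linearl hp // hq // scaler0 addr0.
- by rewrite form_1 Q0.
- by rewrite (form_mulr lamE muE) hp //; apply: QB.
Qed.

Lemma form_1r f : form f 1 = eval0 f.
Proof.
elim/sp_right_ind: f => [k p q hp hq||b p _].
- by rewrite form_linearl hp hq eval0_linear.
- exact: form_1.
rewrite (form_mulr lamE muE) zvar_comm eval0_zvar.
have -> : B b 1 = 0; last by rewrite (form0r lamE muE).
by rewrite [1]sp4_1 [RHS]sp4_0; move: b; apply: ord4P; rewrite (besselE lamE muE); sp_ring.
Qed.

Hypothesis Qg : forall f, Q f -> Q (grade f).

(** The same argument on the other side: by [adjoint_zvar], the variables of g become
Bessel operators applied to f. *)
Lemma form_radicall f g : Q f -> form f g = 0.
Proof.
elim/sp_left_ind: g f => [k p q hp hq f Qf|f Qf|b p hp f Qf].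
- by rewrite (form_linearr lamE muE) hp // hq // scaler0 addr0.
- by rewrite form_1r Q0.
- rewrite (adjoint_zvar lamE muE) hp //; apply: QB.
  by case: (par b) => //=; apply: Qg.
Qed.

End StableSubspace.

(** The superpolynomials with coefficients h, a, b, c on the generators of the ideal:
2 W Y + et z_3 z_4, Y^2, Y z_3 and Y z_4.  For lam = alpha, W = z_1, Y = z_2 and
et = 1; for lam = 1, W = z_2, Y = z_1 and et = 1 / alpha. *)
Definition fock_shape (et : K) (W Y : A) f : Prop := exists a b c h,
  f = sp4 (2%:MP * (W * (Y * h)) + Y * (Y * a)) (Y * b) (Y * c) (et%:MP * h).

Section Shape.
Variables (et et' : K) (W Y : A).
Hypothesis etK : et * et' = 1.
Local Notation Q := (fock_shape et W Y).

Lemma fock_shape_linear k f g : Q f -> Q g -> Q (k *: f + g).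
Proof.
move=> [a [b [c [h ->]]]] [a' [b' [c' [h' ->]]]].
exists (k%:MP * a + a'), (k%:MP * b + b'), (k%:MP * c + c'), (k%:MP * h + h').
by rewrite sp4Z sp4D; apply: sp4_eq; ring.
Qed.

Lemma fock_shape_grade f : Q f -> Q (grade f).
Proof.
move=> [a [b [c [h ->]]]]; exists a, (- b), (- c), h.
by rewrite gradeE; apply: sp4_eq; ring.
Qed.

Let etCK (u : A) : et%:MP * (et'%:MP * u) = u.
Proof. by rewrite mulrA -mpolyCM etK mpolyC1 mul1r. Qed.

Lemma fock_shape_mull g f : Q f -> Q (g * f).
Proof.
move=> [a [b [c [h ->]]]]; elim/sp4_ind: g => g0 g1 g2 g3.
(* Y k is the part of the last component divisible by Y, up to the factor et; it
   must be moved into h, and the first component corrected accordingly. *)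
pose k := et'%:MP * (g3 * (2%:MP * (W * h) + Y * a) + g1 * c - g2 * b).
exists (g0 * a - 2%:MP * (W * k)), (g0 * b + g1 * (2%:MP * (W * h) + Y * a)),
  (g0 * c + g2 * (2%:MP * (W * h) + Y * a)), (g0 * h + Y * k).
rewrite sp4M; apply: sp4_eq; last first.
  by rewrite [RHS]mulrDr [et%:MP * (Y * k)]mulrCA etCK; ring.
all: by rewrite /k; ring.
Qed.

Lemma fock_shape_mulr g f : Q f -> Q (f * g).
Proof.
move=> [a [b [c [h ->]]]]; elim/sp4_ind: g => g0 g1 g2 g3.
pose k := et'%:MP * (g3 * (2%:MP * (W * h) + Y * a) + b * g2 - c * g1).
exists (g0 * a - 2%:MP * (W * k)), (g0 * b + g1 * (2%:MP * (W * h) + Y * a)),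
  (g0 * c + g2 * (2%:MP * (W * h) + Y * a)), (g0 * h + Y * k).
rewrite sp4M; apply: sp4_eq; last first.
  by rewrite [RHS]mulrDr [et%:MP * (Y * k)]mulrCA etCK; ring.
all: by rewrite /k; ring.
Qed.

End Shape.

Lemma fock_shape_eval0 et W i f : fock_shape et W 'X_i f -> eval0 f = 0.
Proof.
move=> [a [b [c [h ->]]]]; rewrite /eval0 ffunE mcoeffD !rmorphM /= !mcoeffX.
by rewrite mnm1_eq0 !(mul0r, mulr0) addr0.
Qed.

(** The Bessel operators preserve the ideal because of the value of lam: for mu = 1,
the terms of B_2 f which are not multiples of Y cancel. *)
Lemma fock_shape_bessel_alpha b f : mu = 1 -> fock_shape 1 x y f -> fock_shape 1 x y (B b f).
Proof.
(* The new h is the last component of B_b f; the other witnesses are then the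
   quotients of the remaining components by the powers of Y. *)
move=> mu1 [p [q [r [h ->]]]]; move: b; apply: ord4P.
- exists (- (al%:MP * d1 p) + x * d1 (d1 p)), (d1 q - al%:MP * d1 q + x * d1 (d1 q)),
    (d1 r - al%:MP * d1 r + x * d1 (d1 r)),
    (2%:MP * d1 h - al%:MP * d1 h + x * d1 (d1 h)).
  by rewrite (besselE lamE muE) mu1 mpolyC1 !mul1r; sp_ring.
- exists (2%:MP * d2 p + d2 p + y * d2 (d2 p)), (2%:MP * d2 q + y * d2 (d2 q)),
    (2%:MP * d2 r + y * d2 (d2 r)), (d2 h + y * d2 (d2 h)).
  by rewrite (besselE lamE muE) mu1 mpolyC1 !mul1r; sp_ring.
- exists (2%:MP * (al%:MP * d2 r) - 2%:MP * (x * d1 (d2 r))),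
    (2%:MP * d2 h - 2%:MP * (al%:MP * d2 h) + 2%:MP * (x * d1 (d2 h))
      + 2%:MP * d1 p + y * d1 (d2 p)),
    0, (d1 r + y * d1 (d2 r)).
  by rewrite (besselE lamE muE) mu1 mpolyC1 !mul1r; sp_ring.
- exists (2%:MP * (x * d1 (d2 q)) - 2%:MP * (al%:MP * d2 q)), 0,
    (2%:MP * d2 h - 2%:MP * (al%:MP * d2 h) + 2%:MP * (x * d1 (d2 h))
      + 2%:MP * d1 p + y * d1 (d2 p)),
    (- (d1 q + y * d1 (d2 q))).
  by rewrite (besselE lamE muE) mu1 mpolyC1 !mul1r; sp_ring.
Qed.

(** The same cancellation as in the previous lemma, after the exchange of the two
even variables. *)
Lemma fock_shape_bessel_one b f : al * mu = 1 -> fock_shape mu y x f -> fock_shape mu y x (B b f).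
Proof.
move=> almu.
have amK (u : A) : al%:MP * (mu%:MP * u) = u by rewrite mulrA -mpolyCM almu mpolyC1 mul1r.
have maK (u : A) : mu%:MP * (al%:MP * u) = u by rewrite mulrCA amK.
have amyK (u : A) : al%:MP * (y * (mu%:MP * u)) = y * u by rewrite [y * _]mulrCA amK.
move=> [p [q [r [h ->]]]]; move: b; apply: ord4P.
- exists (2%:MP * d1 p + d1 p + x * d1 (d1 p)), (2%:MP * d1 q + x * d1 (d1 q)),
    (2%:MP * d1 r + x * d1 (d1 r)), (d1 h + x * d1 (d1 h)).
  by rewrite (besselE lamE muE) !amK ?amyK; sp_ring.
- exists (- (mu%:MP * d2 p) + y * d2 (d2 p)), (d2 q - mu%:MP * d2 q + y * d2 (d2 q)),
    (d2 r - mu%:MP * d2 r + y * d2 (d2 r)), (2%:MP * d2 h - mu%:MP * d2 h + y * d2 (d2 h)).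
  by rewrite (besselE lamE muE); sp_ring.
- exists (2%:MP * d1 r - 2%:MP * (al%:MP * (y * d1 (d2 r)))),
    (2%:MP * d1 h - 2%:MP * (mu%:MP * d1 h) + 2%:MP * (y * d1 (d2 h))
      + 2%:MP * d2 p + x * d1 (d2 p)),
    0, (al%:MP * (d2 r + x * d1 (d2 r))).
  by rewrite (besselE lamE muE) !mderiv_mulC !amK ?amyK ?maK; sp_ring.
- exists (2%:MP * (al%:MP * (y * d1 (d2 q))) - 2%:MP * d1 q), 0,
    (2%:MP * d1 h - 2%:MP * (mu%:MP * d1 h) + 2%:MP * (y * d1 (d2 h))
      + 2%:MP * d2 p + x * d1 (d2 p)),
    (al%:MP * (- (d2 q + x * d1 (d2 q)))).
  by rewrite (besselE lamE muE) !mderiv_mulC !amK ?amyK ?maK; sp_ring.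
Qed.

End Radical.

(** * The Jordan superalgebra acting by vector fields *)
Section Coefficients.
Variable K : fieldType.
Local Notation z m := (zvar K m).
Implicit Type f : superpoly K.

Lemma lin2_mul (k l : K) (p q f : superpoly K) :
  (k *: p + l *: q) * f = k *: (p * f) + l *: (q * f).
Proof. by rewrite mulrDl -!scalerAl. Qed.

Let lin2_mul4 (V : lalgType K) (a b c d a' b' c' d' : K)
    (p q r s p' q' r' s' f1 f2 f3 f4 : V) :
  (a *: p + a' *: p') * f1 + (b *: q + b' *: q') * f2
  + (c *: r + c' *: r') * f3 + (d *: s + d' *: s') * f4 =
  (a *: (p * f1) + a' *: (p' * f1)) + (b *: (q * f2) + b' *: (q' * f2))
  + (c *: (r * f3) + c' *: (r' * f3)) + (d *: (s * f4) + d' *: (s' * f4)).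
Proof. by rewrite !mulrDl -!scalerAl. Qed.

Local Ltac bring := apply: (etrans (lin2_mul4 _ _ _ _ _ _ _ _ _ _ _ _ _ _ _ _ _ _ _ _));
  rewrite ?sp4E ?str_evenE ?str_oddE ?mpolyCM ?mpolyCN ?mpolyC0 ?mpolyCD; sp_ring.

Lemma str_even_coefs n1 n2 h e t f :
  ((2 * n1) *: z i1 + 0 *: z i2) * pd i1 f + (0 *: z i1 + (2 * n2) *: z i2) * pd i2 f
  + ((n1 + n2 + h) *: z i3 + t *: z i4) * pd i3 f
  + (e *: z i3 + (n1 + n2 - h) *: z i4) * pd i4 f = str_even n1 n2 h e t f.
Proof. by elim/sp4_ind: f => a b c d; bring. Qed.

Lemma str_odd_coefs al u3 v3 u4 v4 f :
  (u3 *: z i3 + u4 *: z i4) * pd i1 f + (v3 *: z i3 + v4 *: z i4) * pd i2 f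
  + (- (2 * v4) *: z i1 + - (2 * al * u4) *: z i2) * pd i3 f
  + ((2 * v3) *: z i1 + (2 * al * u3) *: z i2) * pd i4 f = str_odd al u3 v3 u4 v4 f.
Proof. by elim/sp4_ind: f => a b c d; bring. Qed.

End Coefficients.

Section FockRepresentation.
Variables (R : realType) (alpha lam : R).
Local Notation D := 'rV[R]_4.
Local Notation C := R[i].
Local Notation P := (superpoly C).
Local Notation "x %:C" := (real_complex R x).
Local Notation z m := (zvar C m).
Local Notation B := (bessel alpha%:C lam%:C).
Local Notation e m := (jbasis R m).
Implicit Types (a u : D) (T : 'End(D)) (f g p q : P).

Lemma zlinE a : zlin a = (a 0 i1)%:C *: z i1 + (a 0 i2)%:C *: z i2
  + (a 0 i3)%:C *: z i3 + (a 0 i4)%:C *: z i4.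
Proof. by rewrite /zlin big_ord4. Qed.

Lemma bessel_linE a f : bessel_lin alpha lam a f = (a 0 i1)%:C *: B i1 f + (a 0 i2)%:C *: B i2 f
  + (a 0 i3)%:C *: B i3 f + (a 0 i4)%:C *: B i4 f.
Proof. by rewrite /bessel_lin big_ord4. Qed.

Lemma zlin_jev (s t : R) : zlin (jev s t) = s%:C *: z i1 + t%:C *: z i2.
Proof.
rewrite zlinE !mxE /= rmorph0 ?zvar1E ?zvar2E ?zvar3E ?zvar4E ?sp4E.
by apply: sp4_eq; rewrite ?mpolyC0; ring.
Qed.

Lemma zlin_jod (s t : R) : zlin (jod s t) = s%:C *: z i3 + t%:C *: z i4.
Proof.
rewrite zlinE !mxE /= rmorph0 ?zvar1E ?zvar2E ?zvar3E ?zvar4E ?sp4E.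
by apply: sp4_eq; rewrite ?mpolyC0; ring.
Qed.

Lemma pdT_str_even T (n1 n2 h e' t : R) f :
  T (e i1) = jev (2 * n1) 0 -> T (e i2) = jev 0 (2 * n2) ->
  T (e i3) = jod (n1 + n2 + h) t -> T (e i4) = jod e' (n1 + n2 - h) ->
  pdT T f = str_even n1%:C n2%:C h%:C e'%:C t%:C f.
Proof.
move=> T1 T2 T3 T4; rewrite /pdT big_ord4 T1 T2 T3 T4 !zlin_jev !zlin_jod.
have c2 s : (2 * s)%:C = 2 * s%:C by rewrite rmorphM rmorph_nat.
have -> : (n1 + n2 + h)%:C = n1%:C + n2%:C + h%:C by rewrite !rmorphD.
have -> : (n1 + n2 - h)%:C = n1%:C + n2%:C - h%:C by rewrite rmorphB rmorphD.
rewrite !c2 rmorph0; exact: str_even_coefs.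
Qed.

Lemma pdT_str_odd T (u3 v3 u4 v4 : R) f :
  T (e i1) = jod u3 u4 -> T (e i2) = jod v3 v4 ->
  T (e i3) = jev (- (2 * v4)) (- (2 * alpha * u4)) ->
  T (e i4) = jev (2 * v3) (2 * alpha * u3) ->
  pdT T f = str_odd alpha%:C u3%:C v3%:C u4%:C v4%:C f.
Proof.
move=> T1 T2 T3 T4; rewrite /pdT big_ord4 T1 T2 T3 T4 !zlin_jev !zlin_jod.
have c2 s : (2 * s)%:C = 2 * s%:C by rewrite rmorphM rmorph_nat.
have c2a s : (2 * alpha * s)%:C = 2 * alpha%:C * s%:C by rewrite !rmorphM rmorph_nat.
have cN s : (- s)%:C = - s%:C by rewrite rmorphN.
rewrite !cN !c2 !c2a; exact: str_odd_coefs.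
Qed.

End FockRepresentation.

Section Opposite.
Variable K : fieldType.
Implicit Type f : superpoly K.

Lemma str_evenN (h e t : K) f : str_even 0 0 (- h) (- e) (- t) f = - str_even 0 0 h e t f.
Proof. by elim/sp4_ind: f => a b c d; rewrite !str_evenE ?mpolyCN ?mpolyC0; sp_ring. Qed.

Lemma str_oddN (al c d : K) f : str_odd al (- c) c (- d) d f = - str_odd al c (- c) d (- d) f.
Proof. by elim/sp4_ind: f => a b c' d'; rewrite !str_oddE ?mpolyCN ?mpolyC0; sp_ring. Qed.

End Opposite.

Section JordanDerivations.
Variables (R : realType) (alpha : R).
Local Notation D := 'rV[R]_4.
Local Notation e m := (jbasis R m).
Implicit Types (a u : D) (T : 'End(D)).

Lemma jbasisE : [/\ e i1 = jev 1 0, e i2 = jev 0 1, e i3 = jod 1 0 & e i4 = jod 0 1].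
Proof. by split; apply: rV4P; rewrite !mxE. Qed.

Lemma jhomog0E a : jhomog false a -> a = jev (a 0 i1) (a 0 i2).
Proof. by move=> ha; rewrite -{1}ha jpart0E. Qed.

Lemma jhomog1E a : jhomog true a -> a = jod (a 0 i3) (a 0 i4).
Proof. by move=> ha; rewrite -{1}ha jpart1E. Qed.

Lemma jev_inj (s t s' t' : R) : jev s t = jev s' t' -> s = s' /\ t = t'.
Proof.
by move=> h; split; [move/(congr1 (fun v : D => v 0 i1)): h|move/(congr1 (fun v : D => v 0 i2)): h];
  rewrite !mxE.
Qed.

Lemma jod_inj (s t s' t' : R) : jod s t = jod s' t' -> s = s' /\ t = t'.
Proof.
by move=> h; split; [move/(congr1 (fun v : D => v 0 i3)): h|move/(congr1 (fun v : D => v 0 i4)): h];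
  rewrite !mxE.
Qed.

Lemma jev_homog (s t : R) : jhomog false (jev s t).
Proof. by rewrite /jhomog jpart0E !mxE. Qed.

Lemma jod_homog (s t : R) : jhomog true (jod s t).
Proof. by rewrite /jhomog jpart1E !mxE. Qed.

(** The derivation rule on the products e_i e_i and xi eta leaves sl(2): it kills
e_1 and e_2, and then it has trace 0 on the odd part. *)
Lemma even_der T : ehomog false T -> is_superderivation alpha false T ->
  exists h e' t, [/\ T (e i1) = jev 0 0, T (e i2) = jev 0 0,
    T (e i3) = jod h t & T (e i4) = jod e' (- h)].
Proof.
move=> hT dT; have [-> -> -> ->] := jbasisE.
have hev (s t : R) := jhomog0E (ehomog_app hT (jev_homog s t)).
have hod (s t : R) := jhomog1E (ehomog_app hT (jod_homog s t)).
have := dT false _ (jev 1 0) (jev_homog 1 0).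
have := dT false _ (jev 0 1) (jev_homog 0 1).
have := dT true _ (jod 0 1) (jod_homog 1 0).
have -> : jmul alpha (jod 1 0) (jod 0 1) = jev 1 0 + alpha *: jev 0 1.
  by rewrite !jmul_hE; congr jev; ring.
have -> : jmul alpha (jev 1 0) (jev 1 0) = jev 1 0 by rewrite jmul_hE; congr jev; ring.
have -> : jmul alpha (jev 0 1) (jev 0 1) = jev 0 1 by rewrite jmul_hE; congr jev; ring.
rewrite linearD linearZ /= (hev 1 0) (hev 0 1) (hod 1 0) (hod 0 1).
move: (T (jev 1 0) 0 i1) (T (jev 1 0) 0 i2) (T (jev 0 1) 0 i1) (T (jev 0 1) 0 i2)
  (T (jod 1 0) 0 i3) (T (jod 1 0) 0 i4) (T (jod 0 1) 0 i3) (T (jod 0 1) 0 i4)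
  => p q p' q' a b c d; rewrite !jmul_hE expr0.
move=> /jev_inj[h1 h2] /jev_inj[h3 h4] /jev_inj[h5 h6].
have p0 : p = 0 by lra.
have q0 : q = 0 by lra.
have p0' : p' = 0 by lra.
have q0' : q' = 0 by lra.
exists a, c, b; rewrite p0 q0 p0' q0'; split=> //; congr jod.
by move: h1; rewrite p0 p0'; lra.
Qed.

(** The image of e_1 determines the derivation: e_1 e_2 = 0 gives the image of e_2,
and e_1 xi = xi / 2, e_1 eta = eta / 2 give those of xi and eta. *)
Lemma odd_der T : ehomog true T -> is_superderivation alpha true T ->
  exists c d, [/\ T (e i1) = jod c d, T (e i2) = jod (- c) (- d),
    T (e i3) = jev (2 * d) (- (2 * alpha * d)) &
    T (e i4) = jev (- (2 * c)) (2 * alpha * c)].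
Proof.
move=> hT dT; have [-> -> -> ->] := jbasisE.
have hev (s t : R) := jhomog1E (ehomog_app hT (jev_homog s t)).
have hod (s t : R) := jhomog0E (ehomog_app hT (jod_homog s t)).
have := dT false _ (jev 0 1) (jev_homog 1 0).
have := dT false _ (jod 1 0) (jev_homog 1 0).
have := dT false _ (jod 0 1) (jev_homog 1 0).
have -> : jmul alpha (jev 1 0) (jod 0 1) = 2^-1 *: jod 0 1.
  by rewrite !jmul_hE; apply: rV4P; rewrite !mxE /=; ring.
have -> : jmul alpha (jev 1 0) (jod 1 0) = 2^-1 *: jod 1 0.
  by rewrite !jmul_hE; apply: rV4P; rewrite !mxE /=; ring.
have -> : jmul alpha (jev 1 0) (jev 0 1) = 0.
  by rewrite !jmul_hE; apply: rV4P; rewrite !mxE /=; ring.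
rewrite !linearZ linear0 /= (hev 1 0) (hev 0 1) (hod 1 0) (hod 0 1).
move: (T (jev 1 0) 0 i3) (T (jev 1 0) 0 i4) (T (jev 0 1) 0 i3) (T (jev 0 1) 0 i4)
  (T (jod 1 0) 0 i1) (T (jod 1 0) 0 i2) (T (jod 0 1) 0 i1) (T (jod 0 1) 0 i2)
  => c d c' d' x y x' y'; rewrite !jmul_hE expr0.
have Z (s t : R) : 2^-1 *: jev s t = jev (2^-1 * s) (2^-1 * t).
  by apply: rV4P; rewrite !mxE /=; ring.
have -> : 0 = jod 0 0 :> D by apply: rV4P; rewrite !mxE.
rewrite !Z; move=> /jev_inj[h1 h2] /jev_inj[h3 h4] /jod_inj[h5 h6].
by exists c, d; split => //; [congr jod|congr jev|congr jev]; lra.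
Qed.

End JordanDerivations.

Section FockAdjoints.
Variables (R : realType) (alpha lam : R).
Hypothesis alpha0 : alpha != 0.
Local Notation D := 'rV[R]_4.
Local Notation C := R[i].
Local Notation P := (superpoly C).
Local Notation "x %:C" := (real_complex R x).
Local Notation adjoint := (adjoint alpha%:C lam%:C).
Implicit Types (a u : D) (T : 'End(D)) (f g p q : P).

Let lamE : lam%:C = alpha%:C * (lam%:C / alpha%:C).
Proof. by rewrite mulrC divfK // fmorph_eq0. Qed.
Let muE : lam%:C / alpha%:C = lam%:C / alpha%:C. Proof. by []. Qed.

(** Halving the coordinates of a gives the parameters of L_a, for which the adjoint
exchanges equal numbers or changes the sign of 0. *)
Lemma adjoint_pdT_L k a : jhomog k a ->
  adjoint (pdT (L alpha a)) (fun f => pdT (L alpha a) (gradeb k f)).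
Proof.
have [e1 e2 e3 e4] := jbasisE R.
case: k => ha.
  have E f : pdT (L alpha a) f = str_odd alpha%:C (2^-1 * a 0 i3)%:C (2^-1 * a 0 i3)%:C
      (2^-1 * a 0 i4)%:C (2^-1 * a 0 i4)%:C f.
    by apply: pdT_str_odd; rewrite (jhomog1E ha) lfunE /= ?e1 ?e2 ?e3 ?e4 jmul_hE;
      congr (_ _ _); rewrite ?mxE /=; field.
  by move=> p g; rewrite !E; exact: (adjoint_str_odd lamE muE).
have E f : pdT (L alpha a) f = str_even (2^-1 * a 0 i1)%:C (2^-1 * a 0 i2)%:C 0 0 0 f.
  have -> : 0 = 0%:C by rewrite rmorph0.
  by apply: pdT_str_even; rewrite (jhomog0E ha) lfunE /= ?e1 ?e2 ?e3 ?e4 jmul_hE;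
    congr (_ _ _); rewrite ?mxE /=; field.
have := adjoint_str_even lamE muE (2^-1 * a 0 i1)%:C (2^-1 * a 0 i2)%:C 0 0 0.
by rewrite oppr0 => A p g; rewrite !E; exact: A.
Qed.

(** Derivations have the parameters which the adjoint, on top of the parity
involution, turns into their opposites. *)
Lemma adjoint_pdT_der k T : ehomog k T -> is_superderivation alpha k T ->
  adjoint (pdT T) (fun f => - pdT T (gradeb k f)).
Proof.
have c0 : 0 = 0%:C :> C by rewrite rmorph0.
have cN (s : R) : (- s)%:C = - s%:C by rewrite rmorphN.
case: k => hT dT.
  have [c [d [T1 T2 T3 T4]]] := odd_der hT dT.
  have E f : pdT T f = str_odd alpha%:C c%:C (- c%:C) d%:C (- d%:C) f.
    by rewrite -!cN; apply: pdT_str_odd; rewrite ?T1 ?T2 ?T3 ?T4; congr (_ _ _); ring.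
  by move=> p g; rewrite !E (adjoint_str_odd lamE muE) str_oddN.
have [h [e' [t [T1 T2 T3 T4]]]] := even_der hT dT.
have E f : pdT T f = str_even 0 0 h%:C e'%:C t%:C f.
  by rewrite c0; apply: pdT_str_even; rewrite ?T1 ?T2 ?T3 ?T4; congr (_ _ _); ring.
by move=> p g; rewrite !E (adjoint_str_even lamE muE) str_evenN.
Qed.

End FockAdjoints.

(** * Skew-supersymmetry of combinations *)
Section Combinations.
Variables (K : fieldType) (al mu lam : K).
Hypothesis lamE : lam = al * mu.
Hypothesis muE : lam / al = mu.
Local Notation P := (superpoly K).
Local Notation B := (bessel al lam).
Local Notation z b := (zvar K b).
Local Notation adjoint := (adjoint al lam).
Implicit Types f g p q : P.

Lemma adjoint_zvar2 k i j s t : par i = k -> par j = k ->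
  adjoint (fun g => (s *: z i + t *: z j) * g)
    (fun f => s *: B i (gradeb k f) + t *: B j (gradeb k f)).
Proof.
move=> pi pj p g; rewrite lin2_mul -{1}pi -pj.
exact: (adjointD lamE muE (adjointZ lamE muE s (adjoint_zvar lamE muE i))
  (adjointZ lamE muE t (adjoint_zvar lamE muE j))).
Qed.

Lemma adjoint_bessel2 k i j s t : par i = k -> par j = k ->
  adjoint (fun g => s *: B i g + t *: B j g) (fun f => (s *: z i + t *: z j) * gradeb k f).
Proof.
move=> pi pj p g; rewrite lin2_mul.
have -> : z i * gradeb k p = p * z i by rewrite zvar_comm pi.
have -> : z j * gradeb k p = p * z j by rewrite zvar_comm pj.
exact: (adjointD lamE muE (adjointZ lamE muE s (adjoint_bessel lamE muE i))
  (adjointZ lamE muE t (adjoint_bessel lamE muE j))).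
Qed.

Variables (Z Z' b b' S S' : P -> P).
Hypotheses (hZ : adjoint Z b') (hb : adjoint b Z') (hS : adjoint S S').

Lemma adjoint_zvar_add_bessel c d :
  adjoint (fun g => c *: (Z g + b g) + d *: S g)
    (fun f => - (- c *: (Z' f + b' f) + - d *: S' f)).
Proof.
move=> p g; rewrite !scaleNr -opprD opprK [Z' p + _]addrC.
exact: (adjointD lamE muE (adjointZ lamE muE c (adjointD lamE muE hZ hb)) (adjointZ lamE muE d hS)).
Qed.

Lemma adjoint_zvar_sub_bessel c :
  adjoint (fun g => c *: (Z g - b g)) (fun f => - (c *: (Z' f - b' f))).
Proof.
move=> p g; rewrite -scalerN opprB -[b g]scale1r -[Z' p]scale1r -!scaleNr.
exact: (adjointZ lamE muE c (adjointD lamE muE hZ (adjointZ lamE muE (- 1) hb))).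
Qed.

Lemma adjoint_sub_scale c : adjoint (fun g => c *: g - S g) (fun f => c *: f - S' f).
Proof.
move=> p g; rewrite -[S g]scale1r -[S' p]scale1r -!scaleNr.
exact: (adjointD lamE muE (adjointZ lamE muE c (fun p g => erefl)) (adjointZ lamE muE (- 1) hS)).
Qed.

(* The case of an odd L_a, on which the character lambda vanishes. *)
Lemma adjoint_sub_scale0 : adjoint (fun g => 0 *: g - S g)
  (fun f => 0 *: grade f - S' f).
Proof. by move=> p g; rewrite adjoint_sub_scale !scale0r. Qed.

Lemma lin4_left (V : lmodType K) (s t : K) (u v w w' : V) :
  s *: u + t *: v + 0 *: w + 0 *: w' = s *: u + t *: v.
Proof. by rewrite !scale0r !addr0. Qed.

Lemma lin4_right (V : lmodType K) (s t : K) (u v w w' : V) :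
  0 *: w + 0 *: w' + s *: u + t *: v = s *: u + t *: v.
Proof. by rewrite !scale0r !add0r. Qed.

End Combinations.

(** An automorphism phi of the scalars which fixes al and lam; it will be complex
conjugation. *)
Section CoefficientMap.
Variables (K : fieldType) (phi : {rmorphism K -> K}) (al lam : K).
Hypotheses (phi_al : phi al = al) (phi_lam : phi lam = lam).
Local Notation P := (superpoly K).
Local Notation A := {mpoly K[2]}.
Implicit Types f g : P.
Local Notation mp := (map_mpoly phi).

Definition sp_map f : P := [ffun s => mp (f s)].

Lemma sp_map4 a b c d : sp_map (sp4 a b c d) = sp4 (mp a) (mp b) (mp c) (mp d).
Proof. by apply/ffunP => -[[] []]; rewrite !ffunE. Qed.

Lemma sp_mapD f g : sp_map (f + g) = sp_map f + sp_map g.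
Proof. by apply/ffunP => s; rewrite !ffunE rmorphD. Qed.

Lemma sp_mapN f : sp_map (- f) = - sp_map f.
Proof. by apply/ffunP => s; rewrite !ffunE rmorphN. Qed.

Lemma sp_mapZ k f : sp_map (k *: f) = phi k *: sp_map f.
Proof. by apply/ffunP => s; rewrite !ffunE map_mpolyZ. Qed.

Lemma map_mpoly_deriv i (u : A) : mp u^`M(i) = (mp u)^`M(i).
Proof.
by apply/mpolyP => m; rewrite !(mcoeff_deriv, mcoeff_map_mpoly) raddfMn.
Qed.

Lemma sp_map_pd i f : sp_map (pd i f) = pd i (sp_map f).
Proof.
elim/sp4_ind: f => a b c d; move: i; apply: ord4P;
  by rewrite ?(pd1E, pd2E, pd3E, pd4E) !sp_map4 ?(pd1E, pd2E, pd3E, pd4E)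
    ?map_mpoly_deriv ?rmorph0 ?rmorphN.
Qed.

Lemma sp_map_zvar i f : sp_map (zvar K i * f) = zvar K i * sp_map f.
Proof.
elim/sp4_ind: f => a b c d; move: i; apply: ord4P;
  by rewrite zvar_mull !sp_map4 zvar_mull ?rmorphM ?rmorphN ?rmorph0 /= ?map_mpolyX.
Qed.

Let mapD f g f' g' : sp_map f = f' -> sp_map g = g' -> sp_map (f + g) = f' + g'.
Proof. by move=> <- <-; exact: sp_mapD. Qed.
Let mapN f f' : sp_map f = f' -> sp_map (- f) = - f'.
Proof. by move=> <-; exact: sp_mapN. Qed.
Let mapZ k f f' : phi k = k -> sp_map f = f' -> sp_map (k *: f) = k *: f'.
Proof. by move=> pk <-; rewrite sp_mapZ pk. Qed.
Let mapz i f f' : sp_map f = f' -> sp_map (zvar K i * f) = zvar K i * f'.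
Proof. by move=> <-; exact: sp_map_zvar. Qed.

Lemma sp_map_bessel i f : sp_map (bessel al lam i f) = bessel al lam i (sp_map f).
Proof.
have p2 : phi 2 = 2 by rewrite rmorph_nat.
have pN k : phi k = k -> phi (- k) = - k by move=> e; rewrite rmorphN e.
have pM k l : phi k = k -> phi l = l -> phi (k * l) = k * l.
  by move=> e e'; rewrite rmorphM e e'.
have pla : phi (- (lam / al)) = - (lam / al) by apply: pN; rewrite fmorph_div phi_lam phi_al.
have pl : phi (- lam) = - lam := pN _ phi_lam.
have p2l : phi (2 * lam) = 2 * lam := pM _ _ p2 phi_lam.
have p2l' : phi (- (2 * lam)) = - (2 * lam) := pN _ p2l.
have p2a : phi (2 * al) = 2 * al := pM _ _ p2 phi_al.
have p21 : phi (2 * (1 + al)) = 2 * (1 + al).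
  by apply: (pM _ _ p2); rewrite rmorphD rmorph1 phi_al.
have p j : sp_map (pd j f) = pd j (sp_map f) := sp_map_pd j f.
have pp j l : sp_map (pd j (pd l f)) = pd j (pd l (sp_map f)) by rewrite !sp_map_pd.
move: i; apply: ord4P.
- exact: (mapD (mapD (mapD (mapD (mapZ pl (p i1)) (mapz i1 (pp i1 i1)))
    (mapz i3 (pp i3 i1))) (mapz i4 (pp i4 i1))) (mapN (mapZ p2a (mapz i2 (pp i3 i4))))).
- exact: (mapD (mapD (mapD (mapD (mapZ pla (p i2)) (mapz i2 (pp i2 i2)))
    (mapz i3 (pp i3 i2))) (mapz i4 (pp i4 i2))) (mapN (mapZ p2 (mapz i1 (pp i3 i4))))).
- exact: (mapD (mapD (mapD (mapD (mapZ p2l' (p i4)) (mapZ p2 (mapz i1 (pp i1 i4))))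
    (mapZ p2a (mapz i2 (pp i2 i4)))) (mapZ p21 (mapz i3 (pp i3 i4)))) (mapz i3 (pp i1 i2))).
- exact: (mapD (mapD (mapD (mapD (mapZ p2l (p i3)) (mapN (mapZ p2 (mapz i1 (pp i1 i3)))))
    (mapN (mapZ p2a (mapz i2 (pp i2 i3))))) (mapN (mapZ p21 (mapz i4 (pp i4 i3)))))
    (mapz i4 (pp i1 i2))).
Qed.

Lemma sp_map_sum (F : 'I_4 -> P) : sp_map (\sum_m F m) = \sum_m sp_map (F m).
Proof. by rewrite !big_ord4 !sp_mapD. Qed.

Lemma sp_map_zlin (s : 'I_4 -> K) f : (forall m, phi (s m) = s m) ->
  sp_map ((\sum_m s m *: zvar K m) * f) = (\sum_m s m *: zvar K m) * sp_map f.
Proof.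
move=> hs; rewrite !mulr_suml sp_map_sum; apply: eq_bigr => m _.
by rewrite -!scalerAl sp_mapZ hs sp_map_zvar.
Qed.

Lemma sp_map_bessel_lin (s : 'I_4 -> K) f : (forall m, phi (s m) = s m) ->
  sp_map (\sum_m s m *: bessel al lam m f) = \sum_m s m *: bessel al lam m (sp_map f).
Proof.
by move=> hs; rewrite sp_map_sum; apply: eq_bigr => m _; rewrite sp_mapZ hs sp_map_bessel.
Qed.

Lemma sp_map_shape et W Y f : phi et = et -> mp W = W -> mp Y = Y ->
  fock_shape et W Y f -> fock_shape et W Y (sp_map f).
Proof.
move=> pe pW pY [a [b [c [h ->]]]]; exists (mp a), (mp b), (mp c), (mp h).
have p2 : mp 2%:MP = 2%:MP :> A.
  by rewrite map_mpolyC; apply: (congr1 (@mpolyC 2 K)); exact: rmorph_nat.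
have pE : mp et%:MP = et%:MP :> A by rewrite map_mpolyC; apply: (congr1 (@mpolyC 2 K)); exact: pe.
move: (2%:MP : A) (et%:MP : A) p2 pE => w w' p2 pE.
by rewrite sp_map4; apply: sp4_eq; rewrite ?rmorphD !rmorphM /= ?p2 ?pE ?pW ?pY.
Qed.

End CoefficientMap.

Section SkewSupersymmetry.
Variables (K : fieldType) (phi : {rmorphism K -> K}) (al mu lam : K).
Hypothesis lamE : lam = al * mu.
Hypothesis muE : lam / al = mu.
Local Notation P := (superpoly K).
Local Notation adjoint := (adjoint al lam).
Local Notation form := (form al lam).
Local Notation bar := (sp_map phi).
Variable k : bool.
Implicit Types f g : P.

(** Skew-supersymmetry of an operator of parity k, with the sign (-1)^(k |f|) written
by means of the parity involution. *)
Definition skew (S : P -> P) :=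
  forall f g, form (S f) (bar g) = - form (gradeb k f) (bar (S g)).

Lemma skewD S T : skew S -> skew T -> skew (fun f => S f + T f).
Proof.
move=> hS hT f g; rewrite sp_mapD (linD (form_linearl _ _ _)) hS hT.
by rewrite (linD (form_linearr lamE muE _)) opprD.
Qed.

Lemma skew_adjoint S S' : (forall g, bar (S g) = S' (bar g)) ->
  adjoint S' (fun f => - S (gradeb k f)) -> skew S.
Proof.
move=> hS hS' f g; rewrite hS hS' gradebD addbb.
by rewrite (linN (form_linearl _ _ _)) /= opprK.
Qed.

Variables (Z b S : P -> P).
Hypotheses (hZ : adjoint Z (fun f => b (gradeb k f)))
  (hb : adjoint b (fun f => Z (gradeb k f))) (hS : adjoint S (fun f => S (gradeb k f))).
Hypotheses (cZ : forall g, bar (Z g) = Z (bar g)) (cb : forall g, bar (b g) = b (bar g))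
  (cS : forall g, bar (S g) = S (bar g)).

(** The operators z + B and pi(L) are self-adjoint; the sign comes from the
conjugation of i in the second argument. *)
Lemma skew_minus i : phi i = - i -> skew (fun f => - (i / 2) *: (Z f + b f) + i *: S f).
Proof.
move=> phi_i; apply: (@skew_adjoint _ (fun f => (i / 2) *: (Z f + b f) + - i *: S f)).
  move=> g; rewrite sp_mapD !sp_mapZ sp_mapD cZ cb cS phi_i rmorphN rmorphM phi_i fmorphV.
  by rewrite rmorph_nat mulNr opprK.
have := adjoint_zvar_add_bessel lamE muE hZ hb hS (i / 2) (- i).
by rewrite opprK.
Qed.

Lemma skew_plus i : phi i = - i -> skew (fun f => - (i / 2) *: (Z f + b f) - i *: S f).
Proof.
move=> phi_i; apply: (@skew_adjoint _ (fun f => (i / 2) *: (Z f + b f) + i *: S f)).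
  move=> g; rewrite sp_mapD sp_mapN !sp_mapZ sp_mapD cZ cb cS phi_i rmorphN rmorphM phi_i fmorphV.
  by rewrite rmorph_nat mulNr opprK scaleNr opprK.
move=> p g; rewrite (adjoint_zvar_add_bessel lamE muE hZ hb hS (i / 2) i p g).
by rewrite [- i *: _]scaleNr.
Qed.

(** Here the coefficient is real, and the exchange of z and B produces the sign. *)
Lemma skew_sub : skew (fun f => 2^-1 *: (Z f - b f)).
Proof.
apply: (@skew_adjoint _ (fun f => 2^-1 *: (Z f - b f))); last first.
  exact: (adjoint_zvar_sub_bessel lamE muE hZ hb).
by move=> g; rewrite sp_mapZ sp_mapD sp_mapN cZ cb fmorphV rmorph_nat.
Qed.

End SkewSupersymmetry.

Section Generators.
Variable K : fieldType.
Local Notation A := {mpoly K[2]}.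
Local Notation x := ('X_ord0 : A).
Local Notation y := ('X_ord_max : A).
Local Notation z b := (zvar K b).

Lemma fock_gens_shape_alpha g :
  g \in [:: 2 *: (z i1 * z i2) + z i3 * z i4; z i2 ^+ 2; z i2 * z i3; z i2 * z i4] ->
  fock_shape 1 x y g.
Proof.
rewrite !inE expr2 !(zvar1E, zvar2E, zvar3E, zvar4E) !sp4M sp4Z sp4D.
by case/or4P => /eqP ->; [exists 0, 0, 0, 1|exists 1, 0, 0, 0|exists 0, 1, 0, 0|exists 0, 0, 1, 0];
  apply: sp4_eq; rewrite ?mpolyC1; ring.
Qed.

Lemma fock_gens_shape_one (al mu : K) g : al * mu = 1 ->
  g \in [:: (2 * al) *: (z i1 * z i2) + z i3 * z i4; z i1 ^+ 2; z i1 * z i3; z i1 * z i4] ->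
  fock_shape mu y x g.
Proof.
move=> alK; have amK : mu%:MP * al%:MP = 1 :> A by rewrite -mpolyCM mulrC alK mpolyC1.
rewrite !inE expr2 !(zvar1E, zvar2E, zvar3E, zvar4E) !sp4M sp4Z sp4D.
by case/or4P => /eqP ->; [exists 0, 0, 0, al%:MP|exists 1, 0, 0, 0|
    exists 0, 1, 0, 0|exists 0, 0, 1, 0];
  apply: sp4_eq; rewrite ?amK ?mpolyCM; ring.
Qed.

Lemma ideal_gen_shape (et et' : K) (W Y : A) (gs : seq (superpoly K)) f : et * et' = 1 ->
  (forall g, g \in gs -> fock_shape et W Y g) -> f \in ideal_gen gs -> fock_shape et W Y f.
Proof.
move=> etK hg /asboolP[t ht ->].
have h0 : fock_shape et W Y 0.
  by exists 0, 0, 0, 0; rewrite [LHS]sp4_0; apply: sp4_eq; ring.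
have hD : forall f g, fock_shape et W Y f -> fock_shape et W Y g -> fock_shape et W Y (f + g).
  by move=> f1 g1 hf1 hg1; rewrite -[f1]scale1r; apply: fock_shape_linear.
elim: t ht => [|w t IH] ht; first by rewrite big_nil.
rewrite big_cons; apply: hD; last by apply: IH => v vt; apply: ht; rewrite inE vt orbT.
apply: (fock_shape_mulr etK); apply: (fock_shape_mull etK); apply: hg; apply: ht.
exact: mem_head.
Qed.

End Generators.

(** * The Fock representation *)
Section FockProduct.
Variables (R : realType) (alpha lam : R).
Hypothesis alpha0 : alpha != 0.
Local Notation D := 'rV[R]_4.
Local Notation C := R[i].
Local Notation P := (superpoly C).
Local Notation "x %:C" := (real_complex R x).
Local Notation B := (bessel alpha%:C lam%:C).
Local Notation adjoint := (adjoint alpha%:C lam%:C).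
Local Notation form := (form alpha%:C lam%:C).
Local Notation conj := (@sp_conj R).
Implicit Types (a u x : D) (T : 'End(D)) (f g p q : P).

Let mu : C := lam%:C / alpha%:C.
Let lamE : lam%:C = alpha%:C * mu.
Proof. by rewrite /mu mulrC divfK // fmorph_eq0. Qed.
Let muE : lam%:C / alpha%:C = mu. Proof. by []. Qed.

Lemma conj_real (s : R) : Num.conj (s%:C : C) = s%:C.
Proof. exact: conjc_real. Qed.

Lemma fock_ideal_shape (lamP : lam = 1 \/ lam = alpha) :
  exists (Q : P -> Prop), [/\ forall f, f \in fock_ideal alpha lam -> Q f,
    forall b f, Q f -> Q (B b f), forall f, Q f -> eval0 f = 0,
    forall f, Q f -> Q (grade f) & forall f, Q f -> Q (conj f)].
Proof.
have [lama|lama] := eqVneq lam alpha.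
  have mu1 : mu = 1 by rewrite /mu lama divff // fmorph_eq0.
  exists (fock_shape 1 'X_ord0 'X_ord_max); split.
  - move=> f; apply: (ideal_gen_shape (mulr1 1)) => g.
    by rewrite /fock_gens lama eqxx; exact: fock_gens_shape_alpha.
  - by move=> b f; apply: (fock_shape_bessel_alpha lamE muE).
  - by move=> f; apply: fock_shape_eval0.
  - by move=> f; apply: fock_shape_grade.
  - by move=> f; apply: (@sp_map_shape _ Num.conj); rewrite ?rmorph1 // map_mpolyX.
have lam1 : lam = 1 by case: lamP => // /eqP; rewrite (negPf lama).
have amu : alpha%:C * mu = 1 by rewrite -lamE lam1 rmorph1.
exists (fock_shape mu 'X_ord_max 'X_ord0); split.
- move=> f; apply: (ideal_gen_shape (et' := alpha%:C)); first by rewrite mulrC.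
  by move=> g; rewrite /fock_gens (negPf lama); exact: fock_gens_shape_one.
- by move=> b f; apply: (fock_shape_bessel_one lamE muE).
- by move=> f; apply: fock_shape_eval0.
- by move=> f; apply: fock_shape_grade.
- move=> f; apply: (@sp_map_shape _ Num.conj); rewrite ?map_mpolyX //.
  by rewrite fmorph_div; apply: congr2; [|apply: congr1]; exact: conj_real.
Qed.

Lemma fock_ideal_null (lamP : lam = 1 \/ lam = alpha) k f : f \in fock_ideal alpha lam ->
  [/\ forall g, form f g = 0, forall g, form (gradeb k f) g = 0 &
      forall p, form p (conj f) = 0].
Proof.
have [Q [hQ QB Q0 Qg Qc]] := fock_ideal_shape lamP.
move=> /hQ Qf; split.
- by move=> g; apply: (form_radicall lamE muE QB Q0 Qg).
- by move=> g; apply: (form_radicall lamE muE QB Q0 Qg); case: k => //=; apply: Qg.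
- by move=> p; apply: (form_radicalr lamE muE QB Q0); apply: Qc.
Qed.

Lemma adjoint_zlin k a : jhomog k a ->
  adjoint (fun g => zlin a * g) (fun f => bessel_lin alpha lam a (gradeb k f)).
Proof.
have c0 : 0%:C = 0 :> C by rewrite rmorph0.
case: k => ha.
  rewrite (jhomog1E ha) zlin_jod => p g; rewrite bessel_linE !mxE /= c0 lin4_right.
  exact: (@adjoint_zvar2 _ _ _ _ lamE muE true i3 i4 _ _ erefl erefl p g).
rewrite (jhomog0E ha) zlin_jev => p g; rewrite bessel_linE !mxE /= c0 lin4_left.
exact: (@adjoint_zvar2 _ _ _ _ lamE muE false i1 i2 _ _ erefl erefl p g).
Qed.

Lemma adjoint_bessel_lin k a : jhomog k a ->
  adjoint (bessel_lin alpha lam a) (fun f => zlin a * gradeb k f).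
Proof.
have c0 : 0%:C = 0 :> C by rewrite rmorph0.
case: k => ha.
  rewrite (jhomog1E ha) => p g; rewrite zlin_jod bessel_linE !mxE /= c0 lin4_right.
  exact: (@adjoint_bessel2 _ _ _ _ lamE muE true i3 i4 _ _ erefl erefl p g).
rewrite (jhomog0E ha) => p g; rewrite zlin_jev bessel_linE !mxE /= c0 lin4_left.
exact: (@adjoint_bessel2 _ _ _ _ lamE muE false i1 i2 _ _ erefl erefl p g).
Qed.

Lemma adjoint_pi_L k a : jhomog k a ->
  adjoint (pi_L alpha lam a) (fun f => pi_L alpha lam a (gradeb k f)).
Proof.
move=> ha; have hT := adjoint_pdT_L lam alpha0 ha; case: k ha hT => ha hT.
  have l0 : (lamL alpha lam a)%:C = 0.
    by rewrite (jhomog1E ha) /lamL !mxE /= !mulr0 addr0 mulr0 rmorph0.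
  by move=> p g; rewrite /pi_L l0; exact: (adjoint_sub_scale0 lamE muE hT).
by move=> p g; rewrite /pi_L; exact: (adjoint_sub_scale lamE muE hT _ p g).
Qed.

Lemma conj_zlin a g : conj (zlin a * g) = zlin a * conj g.
Proof. by apply: (sp_map_zlin (phi := Num.conj)) => m; exact: conj_real. Qed.

Lemma conj_bessel_lin a g : conj (bessel_lin alpha lam a g) = bessel_lin alpha lam a (conj g).
Proof.
by apply: (sp_map_bessel_lin (phi := Num.conj)) => [||m]; exact: conj_real.
Qed.

Lemma conj_pdT T g : conj (pdT T g) = pdT T (conj g).
Proof.
rewrite /pdT [LHS](sp_map_sum Num.conj); apply: eq_bigr => m _.
by rewrite -[LHS]/(conj _) conj_zlin; apply: congr1; exact: (sp_map_pd Num.conj).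
Qed.

Lemma conj_pi_L a g : conj (pi_L alpha lam a g) = pi_L alpha lam a (conj g).
Proof.
rewrite /pi_L [LHS](sp_mapD Num.conj); apply: congr2.
  by rewrite [LHS](sp_mapZ Num.conj) [X in X *: _]conj_real.
by rewrite [LHS](sp_mapN Num.conj); apply: (congr1 -%R); exact: conj_pdT.
Qed.

Local Notation skew := (skew Num.conj alpha%:C lam%:C).

Lemma conj_i : Num.conj ('i : C) = - 'i.
Proof. exact: conjCi. Qed.

Lemma repr_pi_fock f : exists2 n, n \in fock_ideal alpha lam &
  repr (\pi_(fock alpha lam) f) = f + n.
Proof.
exists (repr (\pi_(fock alpha lam) f) - f); last by rewrite addrC subrK.
by rewrite fock_eq; apply/eqP; exact: reprK.
Qed.

Lemma bessel_fischer_reprl (lamP : lam = 1 \/ lam = alpha) f g :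
  bessel_fischer alpha lam (repr (\pi_(fock alpha lam) f)) g = bessel_fischer alpha lam f g.
Proof.
have [n hn ->] := repr_pi_fock f; have [n0 _ _] := fock_ideal_null lamP false hn.
rewrite -[LHS]/(form (f + n) (conj g)) (linD (form_linearl _ _ _)) n0.
exact: addr0.
Qed.

Lemma bessel_fischer_reprr (lamP : lam = 1 \/ lam = alpha) f g :
  bessel_fischer alpha lam f (repr (\pi_(fock alpha lam) g)) = bessel_fischer alpha lam f g.
Proof.
have [n hn ->] := repr_pi_fock g; have [_ _ n0] := fock_ideal_null lamP false hn.
apply: (@etrans _ _ (form f (conj g) + form f (conj n))).
  rewrite -[LHS]/(form f (conj (g + n))) [conj (g + n)](sp_mapD Num.conj).
  exact: (linD (form_linearr lamE muE f) (conj g) (conj n)).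
apply: (etrans (congr1 (fun t => form f (conj g) + t) (n0 f))); exact: addr0.
Qed.

Lemma gradeb_homog (K : fieldType) k l (f : superpoly K) : sp_homog l f ->
  gradeb k f = (-1) ^+ (k && l) *: f.
Proof.
move=> hf; case: k => /=; last by rewrite expr0 scale1r.
apply/ffunP => s; rewrite !ffunE; case: (eqVneq (s.1 (+) s.2) l) => [->//|sl].
by rewrite (hf s sl) !scaler0.
Qed.

(** A representative of a homogeneous element is homogeneous only modulo the ideal,
which contributes nothing. *)
Lemma form_gradeb_repr (lamP : lam = 1 \/ lam = alpha) j k f g : sp_homog k f ->
  form (gradeb j (repr (\pi_(fock alpha lam) f))) g = (-1) ^+ (j && k) * form f g.
Proof.
move=> hf; have [n hn ->] := repr_pi_fock f; have [_ n0 _] := fock_ideal_null lamP j hn.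
rewrite (linD (gradeb_linear j)) (linD (form_linearl _ _ _)) n0 (gradeb_homog j hf).
by rewrite (linZ (form_linearl _ _ _)) addr0.
Qed.

Lemma skew_rho k X : tkk_homog k X -> skew k (@rho R alpha lam X).
Proof.
case: X => [[u [a T]] x] [hu ha hT hx].
have sm := skew_minus lamE muE (adjoint_zlin hu) (adjoint_bessel_lin hu) (adjoint_pi_L hu)
  (conj_zlin u) (conj_bessel_lin u) (conj_pi_L u) conj_i.
have sp := skew_plus lamE muE (adjoint_zlin hx) (adjoint_bessel_lin hx) (adjoint_pi_L hx)
  (conj_zlin x) (conj_bessel_lin x) (conj_pi_L x) conj_i.
have sl := skew_sub lamE muE (adjoint_zlin ha) (adjoint_bessel_lin ha)
  (conj_zlin a) (conj_bessel_lin a).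
have dT : is_superderivation alpha k T.
  by have /asboolP/(_ k) := der_valP T; rewrite hT.
have sd := skew_adjoint (conj_pdT T) (adjoint_pdT_der lam alpha0 hT dT).
exact: (skewD lamE muE (skewD lamE muE (skewD lamE muE sm sl) sd) sp).
Qed.

End FockProduct.

Theorem proposition6p3 (R : realType) (alpha lam : R)
  (alpha_neq0 : alpha != 0) (alpha_neq1 : alpha != 1)
  (lamP : lam = 1 \/ lam = alpha)
  (x k l : bool) (X : tkk alpha) (p q : fock alpha lam)
  (hX : tkk_homog x X) (hp : fock_homog k p) (hq : fock_homog l q) :
  fock_product (fock_act X p) q
  = - (-1) ^+ (x && k) * fock_product p (fock_act X q).
Proof.
rewrite /fock_product /fock_act (bessel_fischer_reprl alpha_neq0 lamP).
rewrite (bessel_fischer_reprr alpha_neq0 lamP).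
case: hp => f hf ->; rewrite (bessel_fischer_reprl alpha_neq0 lamP).
move: (repr q) => g; apply: (etrans (skew_rho lam alpha_neq0 hX _ g)).
by rewrite (form_gradeb_repr alpha_neq0 lamP _ _ hf) mulNr.
Qed.
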